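(* Let $G$ be a simple graph on vertex set $[2n+1]$, let $u,v\notin[2n+1]$, and order the vertices of the 2-suspension $G^{u,v}$ as $1<2<\cdots<2n+1<u<v$. For an orientation $\omega$ of the triples of $G^{u,v}$ the following are equivalent: (i) $\omega$ is 3-Pfaffian; (ii) with respect to $\omega$: (a) if $C$ is an even cycle of $G$ (where a single edge counts as a cycle of length two) whose complement in $G$ has a quasi-perfect matching, then all edges of $C$ are agreeing and $C$ is oddly oriented; (b) if $xyz$ is a path of length 2 in $G$ whose complement has a perfect matching, then one of the edges $xy,yz$ is agreeing and the other is opposite; (c) if $x_1x_2x_3x_4x_5$ is a path of length 4 in $G$ whose complement has a perfect matching, then $x_2\xrightarrow{u}x_3$ if and only if $x_4\xrightarrow{u}x_3$, and $x_2\xrightarrow{v}x_3$ if and only if $x_4\xrightarrow{v}x_3$.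
   Context: $G^{u,v}$ is the 3-graph on $[2n+1]\cup\{u,v\}$ with triples $\{i,j,u\},\{i,j,v\}$ for each edge $ij$ of $G$. A triple orientation assigns to each triple $\{a,b,c\}$ a cyclic order (a 3-cycle $(a\,b\,c)$ or $(b\,a\,c)$); the canonical orientation of $\{a,b,c\}$ with $a<b<c$ is $(a\,b\,c)$. An edge $ij$ of $G$ is agreeing if the triples $\{i,j,u\}$ and $\{i,j,v\}$ are either both oriented canonically or both oriented opposite to canonically, and opposite otherwise. The $u$-orientation of $G$ orients edge $ij$ with $i<j$ as $i\xrightarrow{u}j$ if $\{i,j,u\}$ has orientation $(i\,j\,u)$ and as $j\xrightarrow{u}i$ otherwise; the $v$-orientation is defined analogously with $v$. An even cycle is oddly oriented if, traversing it cyclically, an odd number of its edges point forward (for agreeing edges the $u$- and $v$-orientations coincide; a cycle of length two, i.e. a single edge, is always oddly oriented). The complement of a subgraph $G'$ is the subgraph of $G$ induced by $V(G)\setminus V(G')$. A quasi-perfect matching is a spanning subgraph whose components are single edges except exactly one path with two edges. Signs of trees: a cycle in a 3-graph is a sequence $a_0,t_1,\dots,t_\ell,a_\ell=a_0$, $\ell\ge2$, of distinct vertices and distinct triples with $a_{i-1},a_i\in t_i$; a spanning tree is a set of triples with no cycle, covering all vertices, connected via paths of triples. Identifying the vertices with $[2n+3]$ by the given order, for a spanning tree $T$ the product of the 3-cycles assigned to its triples is a $(2n+3)$-cycle $(s(1)\cdots s(2n+3))$, and the sign of $T$ is the sign of the permutation $s$ (well defined). $\omega$ is 3-Pfaffian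 if all spanning trees have the same sign. *)

(* Defs.v *)
From mathcomp Require Import all_boot all_fingroup.
Set Implicit Arguments.
Unset Strict Implicit.
Unset Printing Implicit Defensive.

(* A simple graph is a symmetric irreflexive [rel T]; a 3-graph is a set of   *)
(* 3-element sets.                                                            *)

(** ** Graphs *)

Definition induced_edges (T : finType) (e : rel T) (W : {set T}) : {set {set T}} :=
  [set E : {set T} | (E \subset W) &&
    [exists x, exists y, e x y && (E == [set x; y])]].

Definition has_perfect_matching (T : finType) (e : rel T) (W : {set T}) : Prop :=
  exists2 M : {set {set T}}, M \subset induced_edges e W & partition M W.

(* Vertex sets of the components of the graph with vertex set W and edge set M *)
Definition components (T : finType) (M : {set {set T}}) (W : {set T}) :
    {set {set T}} :=
  equivalence_partition (connect [rel x y | [set x; y] \in M]) W.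

Definition is_single_edge (T : finType) (M : {set {set T}}) (B : {set T}) : Prop :=
  exists x y, [/\ x != y, B = [set x; y] & [set x; y] \in M].

Definition is_two_edge_path (T : finType) (M : {set {set T}}) (B : {set T}) : Prop :=
  exists x y z, [/\ uniq [:: x; y; z], B = [set x; y; z],
    [set x; y] \in M, [set y; z] \in M & [set x; z] \notin M].

Definition has_quasi_perfect_matching (T : finType) (e : rel T) (W : {set T}) :
    Prop :=
  exists2 M : {set {set T}}, M \subset induced_edges e W &
  exists2 P : {set T}, P \in components M W /\ is_two_edge_path M P &
    forall B, B \in components M W -> B != P -> is_single_edge M B.

(* The vertices are listed in traversal order.  With size 2 this is a single  *)
(* edge, as [path.cycle e [:: x; y]] unfolds to [e x y && e y x].             *)
Definition even_cycle (T : finType) (e : rel T) (c : seq T) : bool :=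
  [&& 2 <= size c, ~~ odd (size c), uniq c & path.cycle e c].

(** ** Oriented 3-graphs *)

(* The 3-cycle a -> b -> c -> a, for pairwise distinct a, b, c                *)
Definition cyc3 (T : finType) (a b c : T) : {perm T} :=
  (tperm a b * tperm a c)%g.

(* The values of an orientation outside the triples of H are irrelevant.      *)
Definition orientation (T : finType) (H : {set {set T}})
    (omega : {set T} -> {perm T}) : Prop :=
  forall t, t \in H -> exists a b c,
    [/\ uniq [:: a; b; c], t = [set a; b; c] & omega t = cyc3 a b c].

(* The cycle a_0, t_1, a_1, ..., t_l, a_l = a_0 is encoded by [a i] = a_i and *)
(* [t i] = t_(i+1) for i < l; [ordS] is the cyclic successor on 'I_l.         *)
Definition has_cycle (T : finType) (S : {set {set T}}) : Prop :=
  exists (l : nat) (a : 'I_l -> T) (t : 'I_l -> {set T}),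
    [/\ 2 <= l, injective a, injective t &
        forall i, [/\ t i \in S, a i \in t i & a (ordS i) \in t i]].

Definition spanning_tree (T : finType) (H S : {set {set T}}) : Prop :=
  [/\ S \subset H, ~ has_cycle S, cover S = [set: T] &
      forall x y,
        connect [rel a b | [exists t in S, (a \in t) && (b \in t)]] x y].

(* p is the cycle (s(0) s(1) ... s(N-1))                                      *)
Definition is_full_cycle (N : nat) (p s : {perm 'I_N}) : Prop :=
  forall i, p (s i) = s (ordS i).

(* [b] is the parity of s ([true] for sign -1).  For a spanning tree of an    *)
(* oriented 3-graph on an odd number of vertices, b depends neither on the    *)
(* order in which the 3-cycles are multiplied nor on the choice of s.         *)
Definition tree_sign (N : nat) (omega : {set 'I_N} -> {perm 'I_N})
    (S : {set {set 'I_N}}) (b : bool) : Prop :=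
  exists (ts : seq {set 'I_N}) (s : {perm 'I_N}),
    [/\ perm_eq ts (enum S), is_full_cycle (\prod_(t <- ts) omega t)%g s &
        odd_perm s = b].

Definition three_pfaffian (N : nat) (H : {set {set 'I_N}})
    (omega : {set 'I_N} -> {perm 'I_N}) : Prop :=
  exists b, forall S, spanning_tree H S -> tree_sign omega S b.

(* Canonical orientation for the natural order on 'I_N                        *)
Definition canonical (N : nat) (omega : {set 'I_N} -> {perm 'I_N})
    (t : {set 'I_N}) : bool :=
  [exists a : 'I_N, exists b : 'I_N, exists c : 'I_N,
    [&& a < b, b < c, t == [set a; b; c] & omega t == cyc3 a b c]].

(** ** The 2-suspension *)

(* Its vertices are 'I_(2n+1+2): the vertices of G come first, then u and v.  *)
Definition susp_base (n : nat) (i : 'I_(2 * n + 1)) : 'I_(2 * n + 1 + 2) :=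
  lshift 2 i.

Definition susp_u (n : nat) : 'I_(2 * n + 1 + 2) := rshift (2 * n + 1) (@Ordinal 2 0 isT).

Definition susp_v (n : nat) : 'I_(2 * n + 1 + 2) := rshift (2 * n + 1) (@Ordinal 2 1 isT).

Definition susp_triple (n : nat) (i j : 'I_(2 * n + 1)) (w : 'I_(2 * n + 1 + 2)) :
    {set 'I_(2 * n + 1 + 2)} :=
  [set susp_base i; susp_base j; w].

Definition suspension (n : nat) (e : rel 'I_(2 * n + 1)) :
    {set {set 'I_(2 * n + 1 + 2)}} :=
  [set t | [exists i, exists j, e i j &&
    ((t == susp_triple i j (susp_u n)) || (t == susp_triple i j (susp_v n)))]].

Definition agreeing (n : nat)
    (omega : {set 'I_(2 * n + 1 + 2)} -> {perm 'I_(2 * n + 1 + 2)})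
    (i j : 'I_(2 * n + 1)) : bool :=
  canonical omega (susp_triple i j (susp_u n))
    == canonical omega (susp_triple i j (susp_v n)).

Definition opposite (n : nat)
    (omega : {set 'I_(2 * n + 1 + 2)} -> {perm 'I_(2 * n + 1 + 2)})
    (i j : 'I_(2 * n + 1)) : bool :=
  ~~ agreeing omega i j.

(* The edge ij points from i to j in the w-orientation (w is u or v)          *)
Definition arrow (n : nat)
    (omega : {set 'I_(2 * n + 1 + 2)} -> {perm 'I_(2 * n + 1 + 2)})
    (w : 'I_(2 * n + 1 + 2)) (i j : 'I_(2 * n + 1)) : bool :=
  if i < j
  then omega (susp_triple i j w) == cyc3 (susp_base i) (susp_base j) w
  else omega (susp_triple j i w) != cyc3 (susp_base j) (susp_base i) w.

(* Only used together with the condition that all edges of c are agreeing, so *)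
(* that the v-orientation would give the same notion.  For c = [:: x; y] the  *)
(* edge is traversed once in each direction, so the count is 1.               *)
Definition oddly_oriented (n : nat)
    (omega : {set 'I_(2 * n + 1 + 2)} -> {perm 'I_(2 * n + 1 + 2)})
    (c : seq 'I_(2 * n + 1)) : bool :=
  odd (count (fun x => arrow omega (susp_u n) x (next c x)) c).

(* Main.v *)
Require Import Defs.
From mathcomp Require Import all_boot all_fingroup.
From mathcomp Require Import zify.

(* A spanning tree of the suspension is a quasi-perfect matching of G, with   *)
(* path x y z and pairs a b, in which x y is joined to one of u, v, the edge  *)
(* y z to the other one, and each pair to u or v arbitrarily.  Gluing the     *)
(* 3-cycles one leaf at a time shows that, up to the factors given by the     *)
(* arrows, its sign is that of the word y z v x u a1 b1 a2 b2 ...  Comparing  *)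
(* words, condition (b) says that exchanging u and v on the path preserves    *)
(* the sign, (c) that sliding the path from x1 x2 x3 | x4 x5 to               *)
(* x1 x2 | x3 x4 x5 does, and (a) that moving a pair from u to v and          *)
(* switching an alternating even cycle do.                                    *)
(* Conversely, (a) and (b) exclude triangles x y z and paths both of whose    *)
(* ends are adjacent to other pairs.  Hence of two quasi-perfect matchings    *)
(* with different paths, one can always slide the path of the first so as to  *)
(* gain a common edge; once the paths agree, the matchings differ by even     *)
(* alternating cycles, as in Kasteleyn's theorem.                             *)

Set Implicit Arguments.
Unset Strict Implicit.
Unset Printing Implicit Defensive.

(** * Parity of words *)

Section WordParity.

Variable T : finType.
Implicit Types (s A B P : seq T) (p g : {perm T}).

Definition full s := perm_eq s (enum T).

Definition word_parity s : bool :=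
  odd_perm (odflt 1%g [pick p : {perm T} | s == map p (enum T)]).

Lemma fullP s : reflect (uniq s /\ forall x, x \in s) (full s).
Proof.
apply: (iffP idP) => [fs | [us ms]].
  by split=> [|x]; rewrite ?(perm_uniq fs) ?enum_uniq ?(perm_mem fs) ?mem_enum.
by apply: uniq_perm; rewrite ?enum_uniq // => x; rewrite ms mem_enum.
Qed.

Lemma full_perm s t : perm_eq s t -> full s = full t.
Proof. by move=> st; rewrite /full; apply: (permPl st). Qed.

Lemma full_size s : full s -> size s = #|T|.
Proof. by move/perm_size->; rewrite cardE. Qed.

Lemma full_uniq_size s : uniq s -> size s = #|T| -> full s.
Proof.
move=> us ss; apply: uniq_perm; rewrite ?enum_uniq // => x.
have le : size (enum T) <= size s by rewrite -cardE ss.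
by have [] := uniq_min_size us (fun x _ => mem_enum T x) le.
Qed.

Lemma full_word s : full s -> exists p : {perm T}, s = map p (enum T).
Proof.
move=> fs; have [us ms] := fullP _ fs.
pose f x := nth x s (index x (enum T)).
have lt x : index x (enum T) < size s.
  by rewrite (perm_size fs) index_mem mem_enum.
have fI : injective f.
  move=> x y; rewrite /f (set_nth_default y) // => /eqP.
  rewrite nth_uniq // => /eqP /(congr1 (nth x (enum T))).
  by rewrite !nth_index ?mem_enum.
exists (perm fI); case ds: s => [|x0 s'].
  by have := perm_size fs; rewrite ds => /esym/size0nil->.
rewrite -ds; apply: (@eq_from_nth _ x0).
  by rewrite size_map (perm_size fs).
move=> i li; rewrite (nth_map x0) -?(perm_size fs) // permE /f index_uniq
  ?enum_uniq -?(perm_size fs) //.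
exact: set_nth_default.
Qed.

Lemma word_parityE p : word_parity (map p (enum T)) = odd_perm p.
Proof.
rewrite /word_parity; case: pickP => [q /= /eqP E | /(_ p)]; last by rewrite eqxx.
congr odd_perm; apply/permP => x; apply/esym.
by apply: (eq_in_map _ _ _).2 E _ _; rewrite mem_enum.
Qed.

Lemma word_parity_map g s : full s ->
  word_parity (map g s) = odd_perm g (+) word_parity s.
Proof.
move=> /full_word[p ->]; rewrite word_parityE addbC -odd_permM -word_parityE.
by congr word_parity; rewrite -map_comp; apply: eq_map => x; rewrite /= permM.
Qed.

Lemma full_transpose A P B a b :
  full (A ++ b :: P ++ a :: B) = full (A ++ a :: P ++ b :: B).
Proof.
by apply: full_perm; rewrite perm_cat2l; apply/seq.permP => q;
  rewrite /= !count_cat /=; lia.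
Qed.

Lemma word_parity_transpose A P B a b : full (A ++ a :: P ++ b :: B) ->
  word_parity (A ++ b :: P ++ a :: B) = ~~ word_parity (A ++ a :: P ++ b :: B).
Proof.
move=> fs; have [us _] := fullP _ fs.
have : uniq ([:: a; b] ++ A ++ P ++ B).
  rewrite (perm_uniq (_ : perm_eq _ (A ++ a :: P ++ b :: B))) //.
  by apply/seq.permP => q; rewrite !count_cat /= !count_cat /=; lia.
case/andP; rewrite inE negb_or => /andP[ab aN] /andP[bN _].
rewrite -[RHS](addTb) -[true](_ : odd_perm (tperm a b) = _).
  rewrite -word_parity_map // map_cat /= map_cat /= tpermL tpermR.
  have idm C : {subset C <= A ++ P ++ B} -> map (tperm a b) C = C.
    move=> CN; rewrite -[RHS]map_id; apply/eq_in_map => x /CN xN.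
    by rewrite tpermD //; apply: contraTneq xN => <-.
  by rewrite !idm // => x; rewrite !mem_cat => ->; rewrite ?orbT.
by rewrite odd_tperm ab.
Qed.

Lemma word_parity_swap A B a b : full (A ++ a :: b :: B) ->
  word_parity (A ++ b :: a :: B) = ~~ word_parity (A ++ a :: b :: B).
Proof. exact: (@word_parity_transpose A [::]). Qed.

Lemma word_parity_move A P B a : full (A ++ a :: P ++ B) ->
  word_parity (A ++ P ++ a :: B) = odd (size P) (+) word_parity (A ++ a :: P ++ B).
Proof.
elim: P A => [|b P IH] A //= fs.
have fs' : full (rcons A b ++ a :: P ++ B).
  rewrite -(full_perm (_ : perm_eq (A ++ a :: b :: P ++ B) _)) // cat_rcons.
  by rewrite perm_cat2l (perm_catCA [:: a] [:: b]).
rewrite -cat_rcons IH // cat_rcons word_parity_swap //.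
by rewrite addbN addNb.
Qed.

Lemma word_parity_block A P Q B : full (A ++ Q ++ P ++ B) ->
  word_parity (A ++ P ++ Q ++ B) =
  (odd (size P) && odd (size Q)) (+) word_parity (A ++ Q ++ P ++ B).
Proof.
elim: Q A => [|a Q IH] A //= fs; first by rewrite andbF.
have fs' : full (rcons A a ++ Q ++ P ++ B) by rewrite cat_rcons.
rewrite word_parity_move.
  rewrite -cat_rcons IH // cat_rcons.
  by case: (odd (size P)); case: (odd (size Q)); case: word_parity.
rewrite -cat_rcons (full_perm (_ : perm_eq _ (rcons A a ++ Q ++ P ++ B))) //.
by rewrite perm_cat2l perm_catCA.
Qed.

End WordParity.

Section Gluing.

Variable T : finType.
Implicit Types (a b c x : T) (s Z : seq T) (p q g : {perm T}).

Lemma cyc3E a b c x : uniq [:: a; b; c] ->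
  cyc3 a b c x = if x == a then b else if x == b then c
                 else if x == c then a else x.
Proof.
rewrite /= !inE negb_or andbT => /andP[/andP[ab ac] bc].
rewrite /cyc3 permM; case: (x =P a) => [->|/eqP xa].
  by rewrite tpermL tpermD // eq_sym.
case: (x =P b) => [->|/eqP xb]; first by rewrite tpermR tpermL.
have -> : tperm a b x = x by rewrite tpermD // eq_sym.
case: (x =P c) => [->|/eqP xc]; first by rewrite tpermR.
by rewrite tpermD // eq_sym.
Qed.

Lemma cyc3_rot a b c : uniq [:: a; b; c] -> cyc3 a b c = cyc3 b c a.
Proof.
move=> u; have u' : uniq [:: b; c; a] by rewrite -(rot_uniq 2).
apply/permP => x; rewrite !cyc3E //.
move: u; rewrite /= !inE negb_or andbT => /andP[/andP[ab ac] bc].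
by have [->|//] := eqVneq x a; rewrite (negPf ab) (negPf ac).
Qed.

Lemma cyc3_flip_neq a b c : uniq [:: a; b; c] -> cyc3 a b c != cyc3 b a c.
Proof.
move=> u; have u' : uniq [:: b; a; c].
  by rewrite (perm_uniq (_ : perm_eq _ [:: a; b; c])) // (perm_catCA [:: b] [:: a]).
apply/eqP => /permP/(_ a); rewrite !cyc3E // eqxx.
move: u; rewrite /= !inE negb_or andbT => /andP[/andP[ab ac] bc].
by rewrite (negPf ab) => /eqP; rewrite (negPf bc).
Qed.

Lemma odd_cyc3 a b c : uniq [:: a; b; c] -> odd_perm (cyc3 a b c) = false.
Proof.
rewrite /= !inE negb_or andbT => /andP[/andP[ab ac] bc].
by rewrite /cyc3 odd_permM !odd_tperm ab ac.
Qed.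

Lemma next_at_notin c z D x : x \notin z :: D -> next_at x c z D = x.
Proof.
elim: D z => [|d D IH] z /=; first by rewrite inE => /negPf->.
by rewrite inE negb_or => /andP[/negPf-> /IH].
Qed.

Lemma next_at_last c z D : uniq (z :: D) -> next_at (last z D) c z D = c.
Proof.
elim: D z => [|d D IH] z; first by rewrite /= eqxx.
rewrite cons_uniq => /andP[zD uD]; rewrite [LHS]/= IH //.
by case: eqP => // E; rewrite -E mem_last in zD.
Qed.

Lemma next_at_inner z D x : uniq (z :: D) -> x \in z :: D -> x != last z D ->
  exists2 d, d \in D & forall c, next_at x c z D = d.
Proof.
elim: D z => [|d D IH] z; first by rewrite inE /= => _ ->.
rewrite cons_uniq => /andP[zD uD]; rewrite inE /=.
case: eqP => [_ _ _ | _ /= xD nl]; first by exists d; rewrite ?mem_head.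
by have [d' d'D E] := IH _ uD xD nl; exists d'; rewrite // inE d'D orbT.
Qed.

Lemma next_insert A B a b c q : uniq (A ++ a :: b :: c :: B) ->
  q =1 next (A ++ c :: B) ->
  (q * cyc3 a b c)%g =1 next (A ++ a :: b :: c :: B).
Proof.
move=> u qE x; rewrite permM qE.
have uc : uniq (a :: b :: c :: B ++ A).
  by move: u; rewrite -(rot_uniq (size A)) rot_size_cat.
have uA : uniq (A ++ c :: B).
  move: u; rewrite !cat_uniq /= !negb_or.
  by case/and3P=> -> /and3P[_ _ /andP[-> ->]] /and3P[_ _ /andP[-> ->]].
rewrite -(next_rot (size A) uA) -(next_rot (size A) u) !rot_size_cat /=.
move: (B ++ A) uc => D; rewrite -[_ :: _]/([:: a; b] ++ c :: D) cat_uniq.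
case/and3P=> uab /hasPn nD uD.
have aD : a \notin c :: D by apply: contraTN isT => /nD; rewrite !inE eqxx.
have bD : b \notin c :: D by apply: contraTN isT => /nD; rewrite !inE eqxx orbT.
have u3 : uniq [:: a; b; c].
  move: uab aD bD; rewrite /= !inE !negb_or !andbT => -> /andP[-> _] /andP[-> _].
  by [].
rewrite /next /= cyc3E //.
have [-> | xa] := eqVneq x a; first by rewrite next_at_notin // eqxx.
have [-> | xb] := eqVneq x b; first by rewrite next_at_notin // (negPf (_ : b !=
  a)) ?eqxx // eq_sym; move: uab; rewrite /= inE andbT.
have [xD | xD] := boolP (x \in c :: D); last first.
  rewrite !next_at_notin // (negPf xa) (negPf xb).
  by move: xD; rewrite inE negb_or => /andP[/negPf-> _].
have [-> | xl] := eqVneq x (last c D).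
  rewrite !next_at_last // eqxx.
  by move: u3; rewrite /= !inE negb_or andbT => /andP[/andP[_ ac] bc];
    rewrite eq_sym (negPf ac) eq_sym (negPf bc).
have [d dD E] := next_at_inner uD xD xl; rewrite !E.
have dn y : y \notin c :: D -> (d == y) = false.
  by move=> yD; apply: contraNF yD => /eqP <-; rewrite inE dD orbT.
rewrite (dn a) // (dn b) //; case: (d =P c) => // dc.
by move: uD; rewrite /= -dc dD.
Qed.

End Gluing.

(** * Products of 3-cycles along a tree *)

Section LeafwiseTrees.

Variable T : finType.
Implicit Types (x y r : T) (s Z : seq T) (l : seq (T * T * T)).

Definition leaf_word l : seq T := flatten [seq [:: t.1.1; t.1.2] | t <- l].

Definition triple (t : T * T * T) : {set T} := [set t.1.1; t.1.2; t.2].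

(* Each triple (a, b, c) attaches the two new vertices a and b to an earlier  *)
(* vertex c.                                                                  *)
Fixpoint grown (D : seq T) l : bool :=
  if l is (a, b, c) :: l' then (c \in D) && grown (D ++ [:: a; b]) l' else true.

Lemma grown_rcons D l a b c :
  grown D (rcons l (a, b, c)) = grown D l && (c \in D ++ leaf_word l).
Proof.
elim: l D => [|[[a' b'] c'] l IH] D /=; first by rewrite cats0 andbT.
by rewrite IH -catA andbA.
Qed.

Lemma leaf_word_rcons l a b c : leaf_word (rcons l (a, b, c)) = leaf_word l ++ [::
  a; b].
Proof. by rewrite /leaf_word map_rcons flatten_rcons. Qed.

Variable omega : {set T} -> {perm T}.

Definition cyc3_or_flip (t : T * T * T) :=
  omega (triple t) = cyc3 t.1.1 t.1.2 t.2 \/ omega (triple t) = cyc3 t.1.2 t.1.1 t.2.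

Definition flipped (t : T * T * T) := omega (triple t) != cyc3 t.1.1 t.1.2 t.2.

Lemma prod_fix (ts : seq {set T}) x :
  (forall t, t \in ts -> omega t x = x) -> (\prod_(t <- ts) omega t)%g x = x.
Proof.
elim: ts => [|t ts IH] H; first by rewrite big_nil perm1.
rewrite big_cons permM H ?mem_head // IH // => t' t'ts.
by rewrite H // inE t'ts orbT.
Qed.

Lemma prod_even (ts : seq {set T}) :
  (forall t, t \in ts -> odd_perm (omega t) = false) ->
  odd_perm (\prod_(t <- ts) omega t)%g = false.
Proof.
elim: ts => [|t ts IH] H; first by rewrite big_nil odd_perm1.
rewrite big_cons odd_permM H ?mem_head // IH // => t' t'ts.
by rewrite H // inE t'ts orbT.
Qed.

Lemma triple_uniq D l Z t : uniq (D ++ leaf_word l ++ Z) -> grown D l ->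
  t \in l -> uniq [:: t.1.1; t.1.2; t.2].
Proof.
elim: l D => [|[[a b] c] l IH] D //.
rewrite -[leaf_word _]/([:: a; b] ++ leaf_word l) -catA catA => u /andP[cD g].
rewrite inE => /orP[/eqP-> /=|]; last exact: IH g.
move: u; rewrite cat_uniq => /andP[u _]; move: u.
rewrite cat_uniq => /and3P[_ /hasPn nD /=]; rewrite !inE !negb_or !andbT => -> /=.
by apply/andP; split; apply: contraTneq cD => <-; apply: nD; rewrite !inE eqxx ?orbT.
Qed.

Lemma mem_triple D l t x : grown D l -> t \in l -> x \in triple t ->
  x \in D ++ leaf_word l.
Proof.
elim: l D => [|[[a b] c] l IH] D //= /andP[cD g]; rewrite inE => /orP[/eqP->|tl xt].
  rewrite /triple /= !inE !mem_cat !inE => /orP[/orP[]/eqP->|/eqP->].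
  - by rewrite eqxx !orbT.
  - by rewrite eqxx !orbT.
  by rewrite cD.
by have := IH _ g tl xt; rewrite -catA.
Qed.

Lemma omega_fix t x : cyc3_or_flip t -> uniq [:: t.1.1; t.1.2; t.2] ->
  x \notin triple t -> omega (triple t) x = x.
Proof.
move=> o u; rewrite !inE !negb_or => /andP[/andP[xa xb] xc].
have u' : uniq [:: t.1.2; t.1.1; t.2].
  by rewrite (perm_uniq (_ : perm_eq _ [:: t.1.1; t.1.2;
    t.2])) // (perm_catCA [:: t.1.2] [:: t.1.1]).
by case: o => ->; rewrite cyc3E // (negPf xa) (negPf xb) (negPf xc).
Qed.

Lemma omega_even t : cyc3_or_flip t -> uniq [:: t.1.1; t.1.2; t.2] ->
  odd_perm (omega (triple t)) = false.
Proof.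
move=> o u.
have u' : uniq [:: t.1.2; t.1.1; t.2].
  by rewrite (perm_uniq (_ : perm_eq _ [:: t.1.1; t.1.2;
    t.2])) // (perm_catCA [:: t.1.2] [:: t.1.1]).
by case: o => ->; apply: odd_cyc3.
Qed.

(* Removing the last leaf triple t = (a, b, c) from the product A t B: up to  *)
(* conjugation by the even permutation B this is (B A) t, and multiplying the *)
(* cycle B A by t inserts a b (or b a) in front of c.                         *)
Lemma grown_product r l Z (ts : seq {set T}) :
  full (r :: leaf_word l ++ Z) -> grown [:: r] l ->
  (forall t, t \in l -> cyc3_or_flip t) ->
  perm_eq ts (map triple l) ->
  exists s, [/\ full (s ++ Z), (\prod_(t <- ts) omega t)%g =1 next s &
    word_parity (s ++ Z) =
    odd (count flipped l) (+) word_parity (r :: leaf_word l ++ Z)].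
Proof.
elim/last_ind: l Z ts => [|l [[a b] c] IH] Z ts fs.
  move=> _ _ /perm_nilP->; exists [:: r]; split=> // x.
  by rewrite big_nil perm1 /=; case: eqP => // ->.
rewrite grown_rcons => /andP[g cl] o pts.
rewrite leaf_word_rcons -catA in fs *.
have u := (fullP _ fs).1.
have tin : triple (a, b, c) \in ts by rewrite (perm_mem pts) map_rcons mem_rcons
  mem_head.
case: (path.splitPr tin) => A B in pts *.
have pts' : perm_eq (B ++ A) (map triple l).
  by move: pts; rewrite map_rcons perm_sym perm_rcons perm_sym perm_catC cat_cons
    perm_cons.
have ol t : t \in l -> cyc3_or_flip t by move=> tl; apply: o;
  rewrite mem_rcons inE tl orbT.
have [s [fs' qE ps]] := IH _ _ fs g ol pts'.
have oZ z : z \in [:: a, b & Z] -> forall t, t \in A ++ B -> omega t z = z.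
  move=> zZ t tAB.
  have /mapP[t' t'l ->] : t \in map triple l by rewrite -(perm_mem pts') mem_cat
    orbC -mem_cat.
  have ut := @triple_uniq [:: r] l ([:: a; b] ++ Z) t' u g t'l.
  apply: omega_fix => //; first exact: ol.
  apply: contraTN isT => /(mem_triple g t'l) zin.
  move: u; rewrite -cat_cons cat_uniq => /and3P[_ /hasPn/(_ _ zZ)].
  by rewrite zin.
have evB : odd_perm (\prod_(t <- B) omega t)%g = false.
  apply: prod_even => t tB.
  have /mapP[t' t'l ->] : t \in map triple l by rewrite -(perm_mem pts') mem_cat tB.
  apply: omega_even; first exact: ol.
  exact: (@triple_uniq [:: r] l ([:: a; b] ++ Z) t' u g t'l).
set pB := (\prod_(t <- B) omega t)%g in evB *.
have [us' ms'] := fullP _ fs'.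
have cs : c \in s.
  have := ms' c; rewrite mem_cat => /orP[//|cZ].
  by move: u; rewrite -cat_cons cat_uniq => /and3P[_ /hasPn/(_ _ cZ)]; rewrite /= cl.
case: (path.splitPr cs) => P1 P2 in fs' qE ps us' ms' *.
have uabc : uniq [:: a; b; c].
  apply: (@triple_uniq [:: r] (rcons l (a, b, c)) Z (a, b, c)).
  - by rewrite leaf_word_rcons -catA.
  - by rewrite grown_rcons g.
  by rewrite mem_rcons mem_head.
suff [s2 [fs2 q2 ps2]] : exists s2, [/\ full (s2 ++ Z),
    (\prod_(t <- B ++ A) omega t * omega (triple (a, b, c)))%g =1 next s2 &
    word_parity (s2 ++ Z) = flipped (a, b, c) (+) word_parity ((P1 ++ c :: P2) ++
      [:: a, b & Z])].
  exists (map pB s2).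
  have mapZ : map pB s2 ++ Z = map pB (s2 ++ Z).
    rewrite map_cat; congr cat; rewrite -[LHS]map_id; apply/eq_in_map => z zZ.
    rewrite /pB prod_fix // => t tB; apply: oZ; first by rewrite !inE zZ !orbT.
    by rewrite mem_cat tB orbT.
  split.
  - have [u2 m2] := fullP _ fs2.
    apply: full_uniq_size; rewrite mapZ; first by rewrite map_inj_uniq //;
      apply: perm_inj.
    by rewrite size_map full_size.
  - move=> x; rewrite -[x](permKV pB); set y := (pB^-1)%g x.
    rewrite next_map; [|exact: perm_inj|by move: (fullP _ fs2).1;
      rewrite cat_uniq => /and3P[]].
    rewrite -q2 big_cat big_cons big_cat /= -/pB !permM.
    by [].
  rewrite mapZ word_parity_map // evB addFb ps2 ps.
  by rewrite -cats1 count_cat /= addn0 oddD oddb addbA [flipped _ (+) _]addbC.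
have ins d e : uniq (P1 ++ d :: e :: c :: P2 ++ Z) -> uniq (P1 ++ d :: e :: c :: P2).
  by rewrite -!cat_cons catA cat_uniq => /andP[].
have fab : full (P1 ++ a :: b :: c :: P2 ++ Z).
  by rewrite -(full_perm (_ : perm_eq ((P1 ++ c :: P2) ++ [:: a, b & Z]) _)) //
    -!catA perm_cat2l (perm_catCA (c :: P2) [:: a; b]).
have par_ab : word_parity (P1 ++ a :: b :: c :: P2 ++ Z) = word_parity ((P1 ++ c ::
  P2) ++ [:: a, b & Z]).
  by rewrite -catA (@word_parity_block _ P1 [:: a; b] (c :: P2) Z) // catA.
case fl: (flipped (a, b, c)); last first.
  exists (P1 ++ a :: b :: c :: P2); split; last by rewrite -!catA /= par_ab -catA.
    by rewrite -catA.
  move/negbFE/eqP: fl => ->; apply: next_insert => //.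
  by apply: ins; apply: (fullP _ fab).1.
have fba : full (P1 ++ b :: a :: c :: P2 ++ Z).
  by rewrite -(full_perm (_ : perm_eq (P1 ++ a :: b :: c :: P2 ++ Z) _)) //
    perm_cat2l (perm_catCA [:: a] [:: b]).
exists (P1 ++ b :: a :: c :: P2); split.
- by rewrite -catA.
- have -> : omega (triple (a, b, c)) = cyc3 b a c.
    have [|E|//] := o (a, b, c); first by rewrite mem_rcons mem_head.
    by move: fl; rewrite /flipped E eqxx.
  apply: next_insert => //.
  by apply: ins; apply: (fullP _ fba).1.
by rewrite -!catA /= word_parity_swap // par_ab -catA.
Qed.

End LeafwiseTrees.

Lemma ordS_neq N (i : 'I_N) : 1 < N -> ordS i != i.
Proof.
move=> N1; apply/eqP => /(congr1 val) /=.
have [lt | ge] := ltnP i.+1 N; first by rewrite modn_small // => /eqP; rewrite gtn_eqF.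
have -> : i.+1 = N by apply/eqP; rewrite eqn_leq ge ltn_ord.
by rewrite modnn => i0; move: ge; rewrite -i0 leqNgt N1.
Qed.

Lemma next_enum_ord N (i : 'I_N) : next (enum 'I_N) i = ordS i.
Proof.
rewrite next_nth mem_enum index_enum_ord.
case: N i => [[]//|N] i.
case de: (enum 'I_N.+1) => [|y p]; first by have := mem_enum 'I_N.+1 i; rewrite de.
have sz : size (enum 'I_N.+1) = N.+1 by rewrite size_enum_ord.
apply: val_inj => /=.
have [lt | ge] := ltnP i.+1 N.+1.
  rewrite modn_small //.
  have -> : nth y p i = nth y (enum 'I_N.+1) i.+1 by rewrite de.
  by rewrite nth_enum_ord.
have iN : i = N :> nat by apply/eqP; rewrite eqn_leq -ltnS ltn_ord.
rewrite iN modnn nth_default; last by move: sz; rewrite de /= => -[->].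
have -> : y = nth y (enum 'I_N.+1) 0 by rewrite de.
by rewrite nth_enum_ord.
Qed.

Lemma full_cycle_word N (p : {perm 'I_N}) s : full s -> p =1 next s ->
  exists2 sg : {perm 'I_N}, is_full_cycle p sg & odd_perm sg = word_parity s.
Proof.
move=> /full_word[sg ->] pE; exists sg; last by rewrite word_parityE.
move=> i; rewrite pE next_map ?enum_uniq //; last exact: perm_inj.
by rewrite next_enum_ord.
Qed.

(* Two parametrizations of the same N-cycle differ by a power of the standard *)
(* N-cycle, which is even for N odd.                                          *)
Lemma full_cycle_parity N (p s1 s2 : {perm 'I_N}) : odd N ->
  is_full_cycle p s1 -> is_full_cycle p s2 -> odd_perm s1 = odd_perm s2.
Proof.
case: N p s1 s2 => // N p s1 s2 oN c1 c2.
have ordSi : injective (@ordS N.+1) by apply: can_inj (@ordSK _).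
pose c := perm ordSi.
pose g := (s2 * s1^-1)%g.
have gS i : g (ordS i) = ordS (g i).
  by rewrite /g !permM -c2; apply: (canLR (permK s1)); rewrite -c1 permKV.
have cS k i : (c ^+ k.+1)%g i = ordS ((c ^+ k)%g i) by rewrite expgSr permM permE.
have cX k : ((c ^+ k)%g ord0 : nat) = k %% N.+1.
  elim: k => [|k IH]; first by rewrite expg0 perm1 mod0n.
  by rewrite cS /= IH -addn1 modnDml addn1.
have cXi (i : 'I_N.+1) : (c ^+ i)%g ord0 = i.
  by apply: ord_inj; rewrite cX modn_small.
have cg i k : g ((c ^+ k)%g i) = (c ^+ k)%g (g i).
  elim: k => [|k IH]; first by rewrite !perm1.
  by rewrite !cS gS IH.
have gE : g = (c ^+ g ord0)%g.
  apply/permP => i; rewrite -{1}(cXi i) cg -{1}(cXi (g ord0)) -!permM.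
  by rewrite -expgD addnC expgD permM cXi.
have cN : (c ^+ N.+1)%g = 1%g.
  apply/permP => i; rewrite -{1}(cXi i) -permM -expgD addnC expgD permM.
  by rewrite (_ : (c ^+ N.+1)%g ord0 = ord0) ?cXi ?perm1 //; apply: ord_inj;
    rewrite cX modnn.
have oX q k : odd_perm (q ^+ k)%g = odd k && odd_perm (q : {perm 'I_N.+1}).
  elim: k => [|k IH]; first by rewrite odd_perm1.
  by rewrite expgSr odd_permM IH oddS; case: odd_perm; case: odd.
have ce : odd_perm c = false.
  by move: (oX c N.+1); rewrite cN odd_perm1 oN.
have: odd_perm g = false by rewrite gE oX ce andbF.
by rewrite /g odd_permM odd_permV; case: (odd_perm s1); case: (odd_perm s2).
Qed.

Lemma leaf_no_cycle (T : finType) (S : {set {set T}}) (t : {set T}) a b c :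
  ~ has_cycle S -> (forall t', t' \in S -> (a \notin t') && (b \notin t')) ->
  t = [set a; b; c] -> ~ has_cycle (t |: S).
Proof.
move=> nS nab tE [l [v [s [l2 vI sI H]]]]; apply: nS.
exists l, v, s; split=> // i.
have only x j k : (x == a) || (x == b) -> x \in s j -> x \in s k -> j = k.
  move=> xab xj xk; apply: sI.
  have st m : x \in s m -> s m = t.
    move=> xm; have [sm _ _] := H m; move: sm; rewrite in_setU1 => /orP[/eqP//|sS].
    by have /andP[na nb] := nab _ sS; case/orP: xab xm => /eqP->;
      rewrite ?(negPf na) ?(negPf nb).
  by rewrite (st j xj) (st k xk).
have [si vi vSi] := H i; split=> //.
move: si; rewrite in_setU1 => /orP[/eqP sit|//]; exfalso.
have vab j : v j \in s i -> ((v j == a) || (v j == b)) = false -> v j = c.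
  by rewrite sit tE !inE => /orP[->//|/eqP].
case ei: ((v i == a) || (v i == b)).
  have [_ _ vp] := H (ord_pred i); rewrite ord_predK in vp.
  have := only _ _ _ ei vi vp => /(congr1 (@ordS l)); rewrite ord_predK.
  by move/eqP; rewrite (negPf (ordS_neq i l2)).
case eSi: ((v (ordS i) == a) || (v (ordS i) == b)).
  have [_ vp _] := H (ordS i).
  by have /eqP := only _ _ _ eSi vp vSi; rewrite (negPf (ordS_neq i l2)).
have /vI/eqP : v (ordS i) = v i by rewrite (vab _ vSi eSi) (vab _ vi ei).
by rewrite (negPf (ordS_neq i l2)).
Qed.

Section GrownTrees.

Variable T : finType.
Implicit Types (l : seq (T * T * T)).

Lemma grown_new r l a b c t x : uniq (r :: leaf_word (rcons l (a, b, c))) ->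
  grown [:: r] l -> t \in l -> x \in [:: a; b] -> x \notin triple t.
Proof.
rewrite leaf_word_rcons -cat_cons cat_uniq => /and3P[_ /hasPn nD _] g tl xab.
by apply: contra (nD x xab) => /(mem_triple g tl).
Qed.

Lemma grown_uniq r l : uniq (r :: leaf_word l) -> grown [:: r] l ->
  uniq (map (@triple T) l).
Proof.
elim/last_ind: l => // l [[a b] c] IH u; rewrite grown_rcons => /andP[g _].
rewrite map_rcons rcons_uniq IH //; last first.
  by move: u; rewrite leaf_word_rcons -cat_cons cat_uniq => /andP[].
rewrite andbT; apply/mapP => -[t tl E].
have := grown_new u g tl (mem_head a [:: b]).
by rewrite -E /triple !inE eqxx.
Qed.

Lemma grown_no_cycle r l : uniq (r :: leaf_word l) -> grown [:: r] l ->
  ~ has_cycle [set t in map (@triple T) l].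
Proof.
elim/last_ind: l => [|l [[a b] c] IH] u.
  move=> _ [[|k] [v [s [k2 _ _ H]]]] //.
  by have [] := H ord0; rewrite inE.
rewrite grown_rcons => /andP[g _].
have -> : [set t in map (@triple T) (rcons l (a, b, c))] =
    triple (a, b, c) |: [set t in map (@triple T) l].
  by apply/setP => t; rewrite !inE map_rcons mem_rcons inE.
apply: (@leaf_no_cycle _ _ _ a b c) => //.
  by apply: IH => //; move: u; rewrite leaf_word_rcons -cat_cons cat_uniq => /andP[].
move=> t'; rewrite inE => /mapP[t tl ->].
by rewrite !(grown_new u g tl) // !inE eqxx ?orbT.
Qed.

Lemma grown_connect r l (S : {set {set T}}) x : grown [:: r] l ->
  {subset map (@triple T) l <= S} -> x \in r :: leaf_word l ->
  connect [rel a b | [exists t in S, (a \in t) && (b \in t)]] r x.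
Proof.
elim/last_ind: l x => [|l [[a b] c] IH] x.
  by move=> _ _; rewrite inE => /eqP->.
rewrite grown_rcons => /andP[g cl] sub.
have subl : {subset map (@triple T) l <= S}.
  by move=> t tl; apply: sub; rewrite map_rcons mem_rcons inE tl orbT.
rewrite leaf_word_rcons -cat_cons mem_cat => /orP[xl|xab]; first exact: IH.
apply: connect_trans (IH c g subl cl) (connect1 _).
apply/existsP; exists (triple (a, b, c)).
rewrite sub ?map_rcons ?mem_rcons ?mem_head // /triple !inE eqxx orbT /=.
by move: xab; rewrite !inE => ->.
Qed.

Lemma grown_spanning_tree r l (H : {set {set T}}) :
  full (r :: leaf_word l) -> grown [:: r] l -> l != [::] ->
  {subset map (@triple T) l <= H} -> spanning_tree H [set t in map (@triple T) l].
Proof.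
move=> f g l0 sub; have [u m] := fullP _ f.
have con x : connect [rel a b | [exists t in [set t in map (@triple T) l], (a \in
  t) && (b \in t)]] r x.
  by apply: grown_connect (m x) => // t tl; rewrite inE.
have csym : connect_sym [rel a b | [exists t in [set t in map (@triple T) l], (a
  \in t) && (b \in t)]].
  by apply: sym_connect_sym => x y /=; apply: eq_existsb => t;
    rewrite [(x \in t) && _]andbC.
split.
- by apply/subsetP => t; rewrite inE => /sub.
- exact: grown_no_cycle u g.
- apply/setP => x; rewrite inE; apply/bigcupP.
  have /orP[/eqP->|] := m x; last first.
    move=> /flatten_mapP[t tl xt]; exists (triple t); first by rewrite inE map_f.
    by move: xt; rewrite /triple !inE => ->.
  case: l l0 {f sub m con csym u} g => // [[[a b] c] l] _ /= /andP[];
    rewrite inE => /eqP-> _.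
  exists (triple (a, b, r)); last by rewrite /triple !inE eqxx !orbT.
  by rewrite in_set /= mem_head.
by move=> x y; apply: connect_trans (con y); rewrite csym.
Qed.

End GrownTrees.

Lemma grown_tree_sign N omega r l b : odd N -> full (r :: leaf_word l) ->
  grown [:: r] l -> (forall t, t \in l -> cyc3_or_flip omega t) ->
  tree_sign omega [set t in map (@triple 'I_N) l] b <->
  b = odd (count (flipped omega) l) (+) word_parity (r :: leaf_word l).
Proof.
move=> oN f g o; have [u m] := fullP _ f.
have pe : perm_eq (enum [set t in map (@triple 'I_N) l]) (map (@triple 'I_N) l).
  by apply: uniq_perm; rewrite ?enum_uniq ?(grown_uniq u g) // => t;
    rewrite mem_enum inE.
have f0 : full (r :: leaf_word l ++ [::]) by rewrite cats0.
split.
  move=> [ts [s [pts cs <-]]].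
  have pts' := perm_trans pts pe.
  have [w [fw pE pw]] := grown_product f0 g o pts'.
  rewrite cats0 in fw pw; rewrite cats0 in pw; rewrite -pw.
  have [sg csg <-] := full_cycle_word fw pE.
  exact: full_cycle_parity cs csg.
move=> ->; have [w [fw pE pw]] := grown_product f0 g o pe.
rewrite cats0 in fw pw; rewrite cats0 in pw.
have [sg csg osg] := full_cycle_word fw pE.
by exists (enum [set t in map (@triple 'I_N) l]), sg; split; rewrite // osg.
Qed.

(** * Matchings as words *)

Section PairWords.

Variable V : eqType.
Implicit Types (P Q R : seq V) (e : rel V) (f : V -> V -> bool).

(* A word a1 b1 a2 b2 ... encodes the matching {a1 b1, a2 b2, ...}.           *)
Fixpoint edge_pairs e R : bool :=
  match R with
  | [::] => true
  | a :: b :: R' => e a b && edge_pairs e R'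
  | _ => false
  end.

Fixpoint pair_sum f R : bool :=
  if R is a :: b :: R' then f a b (+) pair_sum f R' else false.

Fixpoint steps_sum f x R : bool :=
  if R is y :: R' then f x y (+) steps_sum f y R' else false.

Inductive pair_equiv : seq V -> seq V -> Prop :=
| pair_equiv_refl R : pair_equiv R R
| pair_equiv_skip a b R R' :
    pair_equiv R R' -> pair_equiv (a :: b :: R) (a :: b :: R')
| pair_equiv_flip a b R : pair_equiv (a :: b :: R) (b :: a :: R)
| pair_equiv_swap a b c d R :
    pair_equiv (a :: b :: c :: d :: R) (c :: d :: a :: b :: R)
| pair_equiv_trans R1 R2 R3 :
    pair_equiv R1 R2 -> pair_equiv R2 R3 -> pair_equiv R1 R3.

Lemma pair_ind (S : seq V -> Prop) :
  S [::] -> (forall a, S [:: a]) -> (forall a b R, S R -> S (a :: b :: R)) ->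
  forall R, S R.
Proof.
move=> S0 S1 S2 R; suff [] : S R /\ forall a, S (a :: R) by [].
elim: R => [|b R [IH1 IH2]]; first by split.
by split=> // a; apply: S2.
Qed.

Lemma edge_pairs_even e R : edge_pairs e R -> odd (size R) = false.
Proof.
by elim/pair_ind: R => //= a b R IH /andP[_ /IH]; rewrite negbK.
Qed.

Lemma edge_pairs_cat e P R : odd (size P) = false ->
  edge_pairs e (P ++ R) = edge_pairs e P && edge_pairs e R.
Proof.
elim/pair_ind: P => //= a b P IH; rewrite negbK => oP.
by rewrite IH // andbA.
Qed.

Lemma pair_sum_cat f P R : odd (size P) = false ->
  pair_sum f (P ++ R) = pair_sum f P (+) pair_sum f R.
Proof.
elim/pair_ind: P => //= a b P IH; rewrite negbK => oP.
by rewrite IH // addbA.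
Qed.

Lemma pair_equiv_perm R R' : pair_equiv R R' -> perm_eq R R'.
Proof.
elim=> {R R'} [R|a b R R' _ IH|a b R|a b c d R|R1 R2 R3 _ H1 _ H2] //.
- by rewrite !perm_cons.
- exact: permEl (perm_catCA [:: a] [:: b] R).
- exact: permEl (perm_catCA [:: a; b] [:: c; d] R).
exact: perm_trans H1 H2.
Qed.

Lemma pair_equiv_edges e R R' : symmetric e -> pair_equiv R R' ->
  edge_pairs e R = edge_pairs e R'.
Proof.
move=> se; elim=> {R R'} [R|a b R R' _ IH|a b R|a b c d R|R1 R2 R3 _ H1 _ H2] //=.
- by rewrite IH.
- by rewrite se.
- by rewrite andbCA.
by rewrite H1.
Qed.

Lemma pair_equiv_catl P R R' : odd (size P) = false -> pair_equiv R R' ->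
  pair_equiv (P ++ R) (P ++ R').
Proof.
elim/pair_ind: P => //= a b P IH; rewrite negbK => oP RR'.
by apply: pair_equiv_skip; apply: IH.
Qed.

Lemma pair_equiv_extract e R a : edge_pairs e R -> a \in R ->
  exists b R', pair_equiv R (a :: b :: R').
Proof.
elim/pair_ind: R => //= b c R IH /andP[_ eR].
rewrite !inE => /or3P[/eqP->|/eqP->|aR].
- by exists c, R; apply: pair_equiv_refl.
- by exists b, R; apply: pair_equiv_flip.
have [d [R' RR']] := IH eR aR; exists d, (b :: c :: R').
exact: pair_equiv_trans (pair_equiv_skip _ _ RR') (pair_equiv_swap _ _ _ _ _).
Qed.

(* R and R' contain the two alternating matchings c and rot 1 c of a cycle c: *)
(* an alternating path a q z grows until the R'-partner of z is a.            *)
Lemma alternating_cycle e R R' : symmetric e -> edge_pairs e R ->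
  edge_pairs e R' -> perm_eq R R' -> R != [::] ->
  exists c Q Q', [/\ c != [::], odd (size c) = false, pair_equiv R (c ++ Q),
    pair_equiv R' (rot 1 c ++ Q') & perm_eq Q Q'].
Proof.
move=> se eR eR' pRR'; case dR: R => [//|a R1] _; rewrite -dR.
have [z [Q RQ]] : exists z Q, pair_equiv R (a :: z :: Q).
  by apply: pair_equiv_extract eR _; rewrite dR mem_head.
suff grow k q z' Q1 Q' : size Q1 <= k -> odd (size q) = false ->
    pair_equiv R ((a :: rcons q z') ++ Q1) -> pair_equiv R' (q ++ Q') ->
    perm_eq Q' [:: a, z' & Q1] ->
    exists c Q Q', [/\ c != [::], odd (size c) = false, pair_equiv R (c ++ Q),
      pair_equiv R' (rot 1 c ++ Q') & perm_eq Q Q'].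
  apply: (grow (size Q) [::] z Q R') => //; first exact: pair_equiv_refl.
  by rewrite perm_sym in pRR'; apply: perm_trans pRR' (pair_equiv_perm RQ).
elim: k q z' Q1 Q' => [|k IH] q z' Q1 Q' sQ oq RQ1 RQ' pQ.
all: have eQ' : edge_pairs e Q' by move: eR';
  rewrite (pair_equiv_edges se RQ') edge_pairs_cat // => /andP[].
all: have z'Q : z' \in Q' by rewrite (perm_mem pQ) !inE eqxx orbT.
all: have [m [Q2 Q'Q2]] := pair_equiv_extract eQ' z'Q.
all: have pm : perm_eq (m :: Q2) (a :: Q1)
  by rewrite -(perm_cons z') perm_sym (perm_trans _ (pair_equiv_perm Q'Q2)) //
    perm_sym (permPl pQ) (permEl (perm_catCA [:: a] [:: z'] Q1)).
all: have RQ2 := pair_equiv_trans RQ' (pair_equiv_catl oq Q'Q2).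
all: have [ma | ma] := eqVneq m a.
1,3: exists (a :: rcons q z'), Q1, Q2; split=> //;
  [by rewrite /= size_rcons /= oq
  |by rewrite rot1_cons -cats1 -cats1 -!catA -ma
  |by rewrite perm_sym; move: pm; rewrite ma perm_cons].
all: have mQ1 : m \in Q1 by move: (perm_mem pm m);
  rewrite mem_head inE (negPf ma) => /esym.
  by move: mQ1; rewrite (size0nil (_ : size Q1 = 0)) //; apply/eqP; rewrite -leqn0.
have eQ1 : edge_pairs e Q1.
  move: eR; rewrite (pair_equiv_edges se RQ1) edge_pairs_cat => [/andP[]//|].
  by rewrite /= size_rcons /= oq.
have [r [Q3 Q1Q3]] := pair_equiv_extract eQ1 mQ1.
apply: (IH (q ++ [:: z'; m]) r Q3 Q2).
- by move: sQ; rewrite (perm_size (pair_equiv_perm Q1Q3)) /= => /ltnW.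
- by rewrite size_cat /= addn2 /= oq.
- apply: pair_equiv_trans RQ1 _; rewrite -cats1 -cats1 /= -!catA /=.
  have o : odd (size (a :: q ++ [:: z'])) = false by rewrite /= size_cat /= addn1 /= oq.
  by have := pair_equiv_catl o Q1Q3; rewrite /= -!catA.
- by rewrite -catA.
rewrite -(perm_cons m) (permPl pm); have := pair_equiv_perm Q1Q3.
rewrite -(perm_cons a) => /permPl ->.
by rewrite (permEl (perm_catCA [:: a] [:: m] (r :: Q3))).
Qed.

Lemma pair_sum_cycle f x s z : odd (size s) ->
  pair_sum f (x :: s) (+) pair_sum f (rcons s z) = steps_sum f x (rcons s z).
Proof.
case: s => // b s /=; elim/pair_ind: s x b => [|c|c d s IH] x b //=.
  by move=> _; rewrite !addbF.
rewrite negbK => os; rewrite -(IH c d) //=.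
by case: (f x b); case: (f b c); case: (f c d); case: (pair_sum f s); rewrite /= ?negbK.
Qed.

Lemma edge_pairs_cycle e x s z : odd (size s) ->
  path e x (rcons s z) = edge_pairs e (x :: s) && edge_pairs e (rcons s z).
Proof.
case: s => // b s /=; elim/pair_ind: s x b => [|c|c d s IH] x b //=.
  by rewrite !andbT.
rewrite negbK => os; rewrite (IH c d) //=.
by case: (e x b); case: (e b c); case: (e c d) => //=; rewrite andbF.
Qed.

Lemma steps_sum_count f g x s : fpath g x s ->
  steps_sum f x s = odd (count (fun y => f y (g y)) (belast x s)).
Proof.
elim: s x => //= y s IH x /andP[/eqP <- /IH->].
by rewrite oddD oddb.
Qed.

Lemma count_next_rot f c : uniq c -> odd (size c) = false -> c != [::] ->
  odd (count (fun y => f y (next c y)) c) = pair_sum f c (+) pair_sum f (rot 1 c).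
Proof.
case: c => // x s u os _.
rewrite rot1_cons pair_sum_cycle; last by move: os => /= /negbFE.
by rewrite (steps_sum_count f (cycle_next u)) belast_rcons.
Qed.

Lemma even_cycle_pairs e c : odd (size c) = false -> c != [::] ->
  path.cycle e c = edge_pairs e c && edge_pairs e (rot 1 c).
Proof.
case: c => // x s os _; rewrite rot1_cons -edge_pairs_cycle //.
by move: os => /= /negbFE.
Qed.

End PairWords.

Lemma pair_equiv_parity (V : eqType) (T : finType) (h : V -> T) (e f : rel V)
    (P : seq T) (R R' : seq V) : symmetric e ->
  (forall a b, e a b -> f b a = ~~ f a b) -> edge_pairs e R ->
  full (P ++ map h R) -> pair_equiv R R' ->
  word_parity (P ++ map h R) (+) pair_sum f R =
  word_parity (P ++ map h R') (+) pair_sum f R'.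
Proof.
move=> se fe eR fR RR'; elim: RR' P eR fR => {R R'} [R|a b R R' _ IH|a b R|a b c d
  R|R1 R2 R3 p1 H1 _ H2] P //=.
- move=> /andP[_ eR] fR.
  have := IH (P ++ [:: h a; h b]) eR; rewrite -!catA /= => /(_ fR) E.
  by rewrite addbCA E addbCA.
- by move=> /andP[eab _] fR; rewrite (fe _ _ eab) (@word_parity_swap _ _ _ (h a) (h
    b)) //; case: (f a b); case: word_parity; case: (pair_sum f R).
- move=> _ fR; rewrite (@word_parity_block _ P [:: h c; h d] [:: h a; h b]) //=.
  by congr (_ (+) _); rewrite addbCA.
move=> eR fR; rewrite H1 //; apply: H2; first by rewrite -(pair_equiv_edges se p1).
rewrite -(full_perm (_ : perm_eq (P ++ map h R1) _)) // perm_cat2l.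
exact/perm_map/pair_equiv_perm.
Qed.

Section MatchingWords.

Variables (V : finType) (e : rel V).
Hypotheses (e_sym : symmetric e) (e_irr : irreflexive e).
Implicit Types (R : seq V) (A B D W : {set V}) (M : {set {set V}}).

Fixpoint pair_sets R : seq {set V} :=
  if R is a :: b :: R' then [set a; b] :: pair_sets R' else [::].

Lemma pair_sets_exist (ts : seq {set V}) :
  (forall A, A \in ts -> exists a b, e a b /\ A = [set a; b]) ->
  exists2 R, edge_pairs e R & pair_sets R = ts.
Proof.
elim: ts => [|A ts IH] H; first by exists [::].
have [a [b [eab ->]]] := H A (mem_head _ _).
have [B Bts|R eR <-] := IH; first by apply: H; rewrite inE Bts orbT.
by exists (a :: b :: R); rewrite //= eab.
Qed.

Lemma pair_sets_edge R A : edge_pairs e R -> A \in pair_sets R ->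
  exists a b, [/\ e a b, A = [set a; b], a \in R & b \in R].
Proof.
elim/pair_ind: R => //= a b R IH /andP[eab eR]; rewrite inE => /orP[/eqP->|AR].
  by exists a, b; rewrite !inE !eqxx orbT.
have [c [d [ecd -> cR dR]]] := IH eR AR.
by exists c, d; rewrite !inE cR dR !orbT.
Qed.

Lemma pair_sets_mem R A x : edge_pairs e R -> A \in pair_sets R -> x \in A -> x \in R.
Proof.
by move=> eR AR; have [a [b [_ -> aR bR]]] := pair_sets_edge eR AR;
  rewrite !inE => /orP[]/eqP->.
Qed.

Lemma pair_sets_cover R x : edge_pairs e R -> x \in R ->
  exists2 A, A \in pair_sets R & x \in A.
Proof.
elim/pair_ind: R => //= a b R IH /andP[_ eR];
  rewrite !inE orbA => /orP[xab|/(IH eR)[A AR xA]].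
  by exists [set a; b]; rewrite !inE ?eqxx.
by exists A; rewrite // inE AR orbT.
Qed.

Lemma pair_sets_meet R A B x : uniq R -> edge_pairs e R ->
  A \in pair_sets R -> B \in pair_sets R -> x \in A -> x \in B -> A = B.
Proof.
elim/pair_ind: R => //= a b R IH /and3P[aR bR uR] /andP[_ eR].
rewrite inE negb_or in aR; case/andP: aR => _ aR.
rewrite !inE => /orP[/eqP->|AR] /orP[/eqP->|BR] //.
- by rewrite !inE => /orP[]/eqP-> /(pair_sets_mem eR BR);
    rewrite ?(negPf aR) ?(negPf bR).
- by move=> /(pair_sets_mem eR AR) xR; rewrite !inE => /orP[]/eqP xab; move: xR;
    rewrite xab ?(negPf aR) ?(negPf bR).
exact: IH.
Qed.

Lemma pair_sets_uniq R : edge_pairs e R -> uniq (pair_sets R) ->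
  (forall A B x, A \in pair_sets R -> B \in pair_sets R -> x \in A -> x \in B -> A
    = B) ->
  uniq R.
Proof.
elim/pair_ind: R => //= a b R IH /andP[eab eR] /andP[nR uR] H.
have new x : x \in [set a; b] -> x \notin R.
  move=> xab; apply: contra nR => /(pair_sets_cover eR)[A AR xA].
  by rewrite (H [set a; b] A x) ?mem_head // inE AR orbT.
rewrite inE negb_or !new ?inE ?eqxx ?orbT //= andbT; apply/andP; split.
  by apply: contraTneq eab => ->; rewrite e_irr.
by apply: IH => // A B x AR BR; apply: H; rewrite inE ?AR ?BR orbT.
Qed.

Lemma set2_inj (a b c d : V) : [set a; b] = [set c; d] -> a != b ->
  (a = c /\ b = d) \/ (a = d /\ b = c).
Proof.
move=> E ab; have := set21 a b; have := set22 a b; rewrite E !inE.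
by case/orP=> /eqP bE /orP[]/eqP aE; move: ab; rewrite aE bE ?eqxx; auto.
Qed.

Lemma induced_edge M W a b : M \subset induced_edges e W -> a != b ->
  [set a; b] \in M -> e a b.
Proof.
move=> /subsetP sM ab /sM; rewrite inE => /andP[_ /existsP[c /existsP[d /andP[ecd
  /eqP E]]]].
by have [[-> ->]|[-> ->]] := set2_inj E ab; rewrite // e_sym.
Qed.

Lemma perfect_matchingP W : has_perfect_matching e W <->
  exists R, [/\ uniq R, edge_pairs e R & W = [set x in R]].
Proof.
split=> [[M /subsetP sM /and3P[/eqP cM tM _]] | [R [uR eR ->]]].
  have [A|R eR RM] := @pair_sets_exist (enum M).
    rewrite mem_enum => /sM; rewrite inE => /andP[_ /existsP[a /existsP[b /andP[eab
      /eqP->]]]].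
    by exists a, b.
  have mM A : (A \in pair_sets R) = (A \in M) by rewrite RM mem_enum.
  exists R; split=> //.
    apply: pair_sets_uniq => //; first by rewrite RM enum_uniq.
    move=> A B x; rewrite !mM => AM BM xA xB; apply/eqP; apply: contraTT isT => AB.
    by have := disjointFr (trivIsetP tM A B AM BM AB) xA; rewrite xB.
  rewrite -cM; apply/setP => x; rewrite inE; apply/bigcupP/idP => [[A AM xA]|xR].
    by apply: pair_sets_mem xA => //; rewrite mM.
  by have [A] := pair_sets_cover eR xR; rewrite mM; exists A.
exists [set A in pair_sets R].
  apply/subsetP => A; rewrite !inE => AR;
    have [a [b [eab AE _ _]]] := pair_sets_edge eR AR.
  apply/andP; split; first by apply/subsetP => x /(pair_sets_mem eR AR); rewrite inE.
  by apply/existsP; exists a; apply/existsP; exists b; rewrite eab AE eqxx.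
apply/and3P; split.
- apply/eqP/setP => x; rewrite inE; apply/bigcupP/idP => [[A]|xR].
    by rewrite inE => AR; apply: pair_sets_mem.
  by have [A AR xA] := pair_sets_cover eR xR; exists A; rewrite ?inE.
- apply/trivIsetP => A B; rewrite !inE => AR BR;
    apply: contraNT => /pred0Pn[x /andP[xA xB]].
  by apply/eqP; apply: (pair_sets_meet uR eR AR BR xA).
apply/negP; rewrite inE => /(pair_sets_edge eR)[a [b [_ E _ _]]].
by have := set21 a b; rewrite -E inE.
Qed.

Lemma connect_class M W D a : a \in D -> D \subset W ->
  (forall b, b \in D -> connect [rel x y | [set x; y] \in M] a b) ->
  (forall p q, [set p; q] \in M -> p \in D -> q \in D) ->
  [set b in W | connect [rel x y | [set x; y] \in M] a b] = D.
Proof.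
move=> aD /subsetP DW cD clD; apply/setP => b; rewrite inE;
  apply/andP/idP => [[_ ab]|bD].
  suff: a \in D = (b \in D) by rewrite aD.
  apply: (@closed_connect _ _ (mem D) _ _ _ ab) => p q /= pq.
  by apply/idP/idP; apply: clD; rewrite // setUC.
by rewrite DW ?cD.
Qed.

Lemma pair_connect_sym M : connect_sym [rel x y | [set x; y] \in M].
Proof. by apply: sym_connect_sym => x y /=; rewrite setUC. Qed.

Lemma quasi_perfect_matching_word W : has_quasi_perfect_matching e W ->
  exists x y z R, [/\ uniq [:: x, y, z & R], e x y, e y z, edge_pairs e R &
    W = [set i in [:: x, y, z & R]]].
Proof.
move=> [M sM [P [PM [x [y [z [u3 PE xyM yzM _]]]]] H]].
have /and3P[/eqP cC tC _] : partition (components M W) W.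
  apply: equivalence_partitionP => p q r _ _ _; split; first exact: connect0.
  move=> pq; apply/idP/idP; last exact: connect_trans.
  by apply: connect_trans; rewrite pair_connect_sym.
have [A|R eR RM] := @pair_sets_exist (enum (components M W :\ P)).
  rewrite mem_enum !inE => /andP[AP /H/(_ AP)[a [b [ab AE abM]]]].
  by exists a, b; split=> //; apply: induced_edge sM ab abM.
have mM A : (A \in pair_sets R) = (A != P) && (A \in components M W).
  by rewrite RM mem_enum !inE.
have meet A B i : A \in components M W -> B \in components M W -> i \in A -> i \in
  B -> A = B.
  move=> AM BM iA iB; apply/eqP; apply: contraTT isT => AB.
  by have := disjointFr (trivIsetP tC A B AM BM AB) iA; rewrite iB.
have nR i : i \in P -> i \notin R.
  move=> iP; apply/negP => /(pair_sets_cover eR)[A]; rewrite mM => /andP[AP AM] iA.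
  by case/eqP: AP; apply: meet iA iP.
have uR : uniq R.
  apply: pair_sets_uniq => //; first by rewrite RM enum_uniq.
  by move=> A B i; rewrite !mM => /andP[_ AM] /andP[_ BM]; apply: meet.
exists x, y, z, R.
move: (u3); rewrite /= !inE !negb_or !andbT => /andP[/andP[xy xz] yz].
split=> //.
- by rewrite xy xz yz uR !nR // PE !inE eqxx ?orbT.
- exact: induced_edge sM xy xyM.
- exact: induced_edge sM yz yzM.
have PR i : (i \in P) || (i \in R) = (i \in [:: x, y, z & R]) by rewrite PE !inE !orbA.
rewrite -cC; apply/setP => i; rewrite inE -PR; apply/bigcupP/orP => [[A AM iA]|[iP|iR]].
- have [<-|AP] := eqVneq A P; first by left.
  by right; apply: (pair_sets_mem eR _ iA); rewrite mM AP.
- by exists P.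
by have [A] := pair_sets_cover eR iR; rewrite mM => /andP[_ AM] iA; exists A.
Qed.

Lemma word_quasi_perfect_matching x y z R : uniq [:: x, y, z & R] ->
  e x y -> e y z -> edge_pairs e R ->
  has_quasi_perfect_matching e [set i in [:: x, y, z & R]].
Proof.
move=> u exy eyz eR; pose W := [set i in [:: x, y, z & R]].
have uR : uniq R by move: u => /= /and4P[].
have [u3 nR] : uniq [:: x; y; z] /\ forall i, i \in R -> i \notin [:: x; y; z].
  by move: (u); rewrite (cat_uniq [:: x; y; z]) => /and3P[-> /hasPn H _]; split.
pose M := [set A in [:: [set x; y], [set y; z] & pair_sets R]].
have inM A : A \in M -> [\/ A = [set x; y], A = [set y; z] | A \in pair_sets R].
  by rewrite !inE => /or3P[/eqP|/eqP|]; [constructor 1|constructor 2|constructor 3].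
have RM A : A \in pair_sets R -> A \in M by move=> AR; rewrite !inE AR !orbT.
have sub3 A : A = [set x; y] \/ A = [set y; z] -> A \subset [set x; y; z].
  by case=> ->; apply/subsetP => i; rewrite !inE => /orP[]->; rewrite ?orbT.
have class3 a : a \in [set x; y; z] ->
    [set b in W | connect [rel p q | [set p; q] \in M] a b] = [set x; y; z].
  move=> a3; apply: connect_class => //.
  - by apply/subsetP => i; rewrite !inE -!orbA => /or3P[]->; rewrite ?orbT.
  - have cy b : b \in [set x; y; z] -> connect [rel p q | [set p; q] \in M] y b.
      rewrite !inE -!orbA => /or3P[]/eqP->; [|exact: connect0|].
        by apply: connect1; rewrite /= [[set y; x]]setUC !inE eqxx.
      by apply: connect1; rewrite /= !inE eqxx orbT.
    by move=> b b3; apply: connect_trans (cy b b3); rewrite pair_connect_sym; apply: cy.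
  move=> p q /inM[E|E|pqR] p3.
  - by apply: (subsetP (sub3 _ (or_introl (erefl _)))); rewrite -E set22.
  - by apply: (subsetP (sub3 _ (or_intror (erefl _)))); rewrite -E set22.
  have /nR := pair_sets_mem eR pqR (set21 p q).
  by move: p3; rewrite !inE -!orbA => ->.
have classR A a : A \in pair_sets R -> a \in A ->
    [set b in W | connect [rel p q | [set p; q] \in M] a b] = A.
  move=> AR aA; apply: connect_class => //.
  - by apply/subsetP => i /(pair_sets_mem eR AR); rewrite !inE => ->; rewrite !orbT.
  - have [p [q [_ AE _ _]]] := pair_sets_edge eR AR.
    move=> b; have AM := RM _ AR; rewrite AE in aA AM *; move: aA; rewrite !inE.
    by do 2!case/orP=> /eqP->; rewrite ?connect0 // connect1 //= setUC.
  move=> p q pqM pA; have pR := pair_sets_mem eR AR pA; have := nR _ pR.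
  have := inM _ pqM => -[E|E|pqR].
  - by have := set21 p q; rewrite E !inE => /orP[]->; rewrite ?orbT.
  - by have := set21 p q; rewrite E !inE => /orP[]->; rewrite ?orbT.
  by rewrite -(pair_sets_meet uR eR pqR AR (set21 p q) pA) set22.
move: (u3); rewrite /= !inE !negb_or !andbT => /andP[/andP[xy xz] yz].
exists M.
  apply/subsetP => A AM; rewrite inE.
  have [a [b [eab AE aW bW]]] : exists a b, [/\ e a b, A = [set a;
    b], a \in W & b \in W].
    have [->|->|AR] := inM _ AM.
    - by exists x, y; rewrite !inE !eqxx ?orbT.
    - by exists y, z; rewrite !inE !eqxx ?orbT.
    have [a [b [eab AE aR bR]]] := pair_sets_edge eR AR.
    by exists a, b; rewrite !inE aR bR !orbT.
  apply/andP; split; first by rewrite AE subUset !sub1set aW bW.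
  by apply/existsP; exists a; apply/existsP; exists b; rewrite eab AE eqxx.
exists [set x; y; z].
  split; first by apply/imsetP; exists x; rewrite ?class3 ?inE ?eqxx.
  exists x, y, z; split=> //; rewrite ?inE ?eqxx ?orbT //.
  rewrite !negb_or; apply/and3P; split.
  - apply/eqP => E; have := set22 x z; rewrite E !inE [z == x]eq_sym (negPf xz) /=.
    by rewrite eq_sym (negPf yz).
  - by apply/eqP => E; have := set21 x z; rewrite E !inE (negPf xy) (negPf xz).
  apply/negP => /(pair_sets_mem eR)/(_ (set21 x z))/nR.
  by rewrite inE eqxx.
move=> B /imsetP[a aW ->] nB.
move: aW; rewrite !inE !orbA => /orP[a3|aR].
  by case/eqP: nB; apply: class3; rewrite !inE.
have [A AR aA] := pair_sets_cover eR aR; rewrite -/W (classR A a AR aA).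
have [p [q [epq AE _ _]]] := pair_sets_edge eR AR.
exists p, q; split=> //; last by rewrite -AE RM.
by apply: contraTneq epq => ->; rewrite e_irr.
Qed.

End MatchingWords.

Lemma cyc3_same_set (T : finType) (a b c i j k : T) :
  uniq [:: a; b; c] -> uniq [:: i; j; k] -> [set a; b; c] = [set i; j; k] ->
  cyc3 a b c = cyc3 i j k \/ cyc3 a b c = cyc3 j i k.
Proof.
move=> u v E.
have v' : uniq [:: j; i; k] by rewrite (perm_uniq (permEl (perm_catCA [:: j] [:: i]
  [:: k]))).
have ma : a \in [set i; j; k] by rewrite -E !inE eqxx.
have mb : b \in [set i; j; k] by rewrite -E !inE eqxx orbT.
have mc : c \in [set i; j; k] by rewrite -E !inE eqxx orbT.
move: u; rewrite /= !inE negb_or andbT => /andP[/andP[ab ac] bc].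
move: ma mb mc ab ac bc; rewrite !inE -!orbA.
move=> /or3P[]/eqP-> /or3P[]/eqP-> /or3P[]/eqP->; rewrite ?eqxx // => _ _ _.
- by left.
- by right; rewrite [RHS]cyc3_rot //.
- by right.
- by left; rewrite [RHS]cyc3_rot //.
- by left; rewrite [LHS]cyc3_rot // -(rot_uniq 1).
by right; rewrite [LHS]cyc3_rot // -(rot_uniq 1).
Qed.

(** * Trees and signs in the suspension *)

Section Suspension.

Variables (n : nat) (e : rel 'I_(2 * n + 1)).
Variable omega : {set 'I_(2 * n + 1 + 2)} -> {perm 'I_(2 * n + 1 + 2)}.
Hypotheses (e_sym : symmetric e) (e_irr : irreflexive e).
Hypothesis omega_or : orientation (suspension e) omega.

Notation V := 'I_(2 * n + 1).
Notation U := 'I_(2 * n + 1 + 2).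
Notation base := (@susp_base n).
Implicit Types (x y z i j : V) (R : seq V) (alpha : V -> bool).

Definition apex (w : bool) : U := if w then susp_u n else susp_v n.

Definition arr (w : bool) i j : bool := arrow omega (apex w) i j.

Lemma base_inj : injective base. Proof. exact: lshift_inj. Qed.

Lemma base_apex i w : (base i == apex w) = false.
Proof. by apply/eqP => /(congr1 val) /=; case: w => /= E; have := ltn_ord i;
  rewrite E -ltn_subRL subnn. Qed.

Lemma apex_inj : injective apex.
Proof. by case; case => // /(congr1 val) /= /eqP; rewrite eqn_add2l. Qed.

Lemma apexN w : (apex w == apex (~~ w)) = false.
Proof. by rewrite (inj_eq apex_inj); case: w. Qed.

Lemma edge_neq i j : e i j -> i != j.
Proof. by apply: contraTneq => ->; rewrite e_irr. Qed.

Lemma triple_uniq_susp i j w : i != j -> uniq [:: base i; base j; apex w].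
Proof. by move=> ij; rewrite /= !inE (inj_eq base_inj) !base_apex (negPf ij). Qed.

Lemma susp_tripleC i j w : susp_triple i j w = susp_triple j i w.
Proof. by rewrite /susp_triple [[set susp_base i; _]]setUC. Qed.

Lemma suspension_triple i j w : e i j -> susp_triple i j (apex w) \in suspension e.
Proof.
move=> eij; rewrite inE; apply/existsP; exists i; apply/existsP; exists j.
by rewrite eij; case: w; rewrite eqxx ?orbT.
Qed.

Lemma suspensionP t : t \in suspension e ->
  exists i j w, e i j /\ t = susp_triple i j (apex w).
Proof.
rewrite inE => /existsP[i /existsP[j /andP[eij /orP[]/eqP->]]].
  by exists i, j, true.
by exists i, j, false.
Qed.

Lemma omega_triple i j w : e i j ->
  omega (susp_triple i j (apex w)) = cyc3 (base i) (base j) (apex w) \/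
  omega (susp_triple i j (apex w)) = cyc3 (base j) (base i) (apex w).
Proof.
move=> eij; have [a [b [c [u tE ->]]]] := omega_or (suspension_triple w eij).
by apply: cyc3_same_set => //; apply: triple_uniq_susp (edge_neq eij).
Qed.

Lemma arrE w i j : e i j ->
  arr w i j = (omega (susp_triple i j (apex w)) == cyc3 (base i) (base j) (apex w)).
Proof.
move=> eij; rewrite /arr /arrow; case: ltnP => // ji.
rewrite susp_tripleC.
have /cyc3_flip_neq ne := triple_uniq_susp w (edge_neq eij).
have [->|->] := omega_triple w eij; first by rewrite eqxx ne.
by rewrite eqxx eq_sym (negPf ne).
Qed.

Lemma arrC w i j : e i j -> arr w j i = ~~ arr w i j.
Proof.
move=> eij; have eji : e j i by rewrite e_sym.
rewrite !arrE // susp_tripleC.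
have /cyc3_flip_neq ne := triple_uniq_susp w (edge_neq eij).
have [->|->] := omega_triple w eij; first by rewrite eqxx (negPf ne).
by rewrite eqxx eq_sym (negPf ne).
Qed.

Lemma canonicalE w i j : e i j -> i < j ->
  canonical omega (susp_triple i j (apex w)) = arr w i j.
Proof.
move=> eij ij; rewrite arrE //.
have jw : base j < apex w.
  by apply: (leq_trans (ltn_ord j)); case: w; apply: leq_addr.
apply/existsP/idP => [[a /existsP[b /existsP[c /and4P[ab bc /eqP tE /eqP ->]]]]|om].
  suff [-> -> ->] : [/\ a = base i, b = base j & c = apex w] by [].
  have ma : a \in susp_triple i j (apex w) by rewrite tE !inE eqxx.
  have mb : b \in susp_triple i j (apex w) by rewrite tE !inE eqxx orbT.
  have mc : c \in susp_triple i j (apex w) by rewrite tE !inE eqxx orbT.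
  have ij' : base i < base j by [].
  have gt (p q : U) : p < q -> (q < p) = false by move/ltnW; rewrite leqNgt => /negPf.
  move: (ltn_trans ij' jw) (ltn_trans ab bc) => iw ac.
  move: ma mb mc ab bc ac; rewrite !inE -!orbA.
  by move=> /or3P[]/eqP-> /or3P[]/eqP-> /or3P[]/eqP->;
    rewrite ?ltnn ?(gt _ _ ij') ?(gt _ _ jw) ?(gt _ _ iw).
exists (base i); apply/existsP; exists (base j); apply/existsP; exists (apex w).
by rewrite om jw eqxx !andbT.
Qed.

Lemma agreeingE i j : e i j -> agreeing omega i j = (arr true i j == arr false i j).
Proof.
move=> eij; have eji : e j i by rewrite e_sym.
rewrite /agreeing -/(apex true) -/(apex false).
have [ij|ji] := ltnP i j; first by rewrite !canonicalE.
have {}ji : j < i by rewrite ltn_neqAle ji andbT; apply: edge_neq.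
rewrite ![susp_triple i j _]susp_tripleC !canonicalE // !(arrC _ eij).
by case: arr; case: arr.
Qed.

Fixpoint pair_triples alpha R : seq (U * U * U) :=
  if R is a :: b :: R' then (base a, base b, apex (alpha a)) :: pair_triples alpha R'
  else [::].

(* The leaf construction, from the root y, of the spanning tree consisting of *)
(* the triples x y (apex w), y z (apex (~~ w)) and a b (apex (alpha a)) for   *)
(* the pairs a b of R.                                                        *)
Definition tree_triples w x y z alpha R : seq (U * U * U) :=
  [:: (base z, apex (~~ w), base y), (base x, apex w, base y) & pair_triples alpha R].

Definition tree_set w x y z alpha R : {set {set U}} :=
  [set t in map (@triple _) (tree_triples w x y z alpha R)].

Definition tree_word w x y z R : seq U :=
  [:: base y; base z; apex (~~ w); base x; apex w] ++ map base R.

Definition tree_parity w x y z alpha R : bool :=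
  word_parity (tree_word w x y z R) (+)
  (~~ arr (~~ w) y z (+) ~~ arr w y x (+)
   pair_sum (fun a b => ~~ arr (alpha a) a b) R).

Definition qpm_word x y z R : bool :=
  [&& full [:: x, y, z & R], e x y, e y z & edge_pairs e R].

Lemma full_tree_word w x y z R : full [:: x, y, z & R] -> full (tree_word w x y z R).
Proof.
move=> f; have [u m] := fullP _ f; apply: full_uniq_size; last first.
  have := full_size f; rewrite /= !card_ord size_map => sR.
  by rewrite -[in RHS](addn0 (2 * n + 1)) -[in RHS]sR; move: (size R) => k;
    rewrite addn0 addn2.
pose s := map base [:: x, y, z & R] ++ [:: apex w; apex (~~ w)].
have us : uniq s.
  have nb w' : apex w' \notin map base [:: x, y, z & R].
    by apply/mapP => -[i _ /esym/eqP]; rewrite base_apex.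
  rewrite cat_uniq map_inj_uniq ?u; last exact: base_inj.
  apply/and3P; split=> //; last by rewrite /= inE apexN.
  by apply/hasPn => q; rewrite !inE => /orP[]/eqP->; apply: nb.
rewrite (perm_uniq (_ : perm_eq _ s)) //.
apply/seq.permP => q; rewrite /s /tree_word !count_cat /= !addn0.
lia.
Qed.

Lemma leaf_word_pairs alpha R : odd (size R) = false ->
  leaf_word (pair_triples alpha R) = map base R.
Proof.
elim/pair_ind: R => //= a b R IH; rewrite negbK => /IH E.
by rewrite -E.
Qed.

Lemma grown_pairs alpha R D : apex true \in D -> apex false \in D ->
  grown D (pair_triples alpha R).
Proof.
elim/pair_ind: R D => //= a b R IH D Dt Df.
rewrite IH ?mem_cat ?Dt ?Df //.
by case: (alpha a); rewrite ?Dt ?Df.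
Qed.

Lemma tree_triples_grown w x y z alpha R :
  grown [:: base y] (tree_triples w x y z alpha R).
Proof.
rewrite /= !inE eqxx /=; apply: grown_pairs; case: w; by rewrite !inE eqxx !orbT.
Qed.

Lemma tree_leaf_word w x y z alpha R : odd (size R) = false ->
  base y :: leaf_word (tree_triples w x y z alpha R) = tree_word w x y z R.
Proof. by move=> oR; rewrite /tree_word -(leaf_word_pairs alpha oR). Qed.

Lemma pair_triples_edge alpha R t : edge_pairs e R -> t \in pair_triples alpha R ->
  exists a b, [/\ e a b, t = (base a, base b, apex (alpha a)) & a \in R].
Proof.
elim/pair_ind: R => //= a b R IH /andP[eab eR]; rewrite inE => /orP[/eqP->|/(IH eR)].
  by exists a, b; rewrite mem_head.
by move=> [c [d [ecd -> cR]]]; exists c, d; rewrite !inE cR !orbT.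
Qed.

Lemma triple_apex i j w : triple (base i, apex w, base j) = susp_triple j i (apex w).
Proof. by rewrite susp_tripleC /triple /susp_triple /= setUAC. Qed.

Lemma flipped_apex i j w : e j i ->
  cyc3_or_flip omega (base i, apex w, base j) /\
  flipped omega (base i, apex w, base j) = ~~ arr w j i.
Proof.
move=> eji; have eij : e i j by rewrite e_sym.
have c1 : cyc3 (base i) (apex w) (base j) = cyc3 (base j) (base i) (apex w).
  by rewrite [RHS]cyc3_rot // triple_uniq_susp // edge_neq.
have c2 : cyc3 (apex w) (base i) (base j) = cyc3 (base i) (base j) (apex w).
  rewrite cyc3_rot //.
  by have := triple_uniq_susp w (edge_neq eij); rewrite -(rot_uniq 2).
rewrite /cyc3_or_flip /flipped triple_apex /= c1 c2 arrE //.
by split=> //; apply: omega_triple.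
Qed.

Lemma flipped_pair i j w : e i j ->
  cyc3_or_flip omega (base i, base j, apex w) /\
  flipped omega (base i, base j, apex w) = ~~ arr w i j.
Proof. by move=> eij; split; [apply: omega_triple | rewrite /flipped arrE]. Qed.

Lemma tree_setP w x y z alpha R : qpm_word x y z R ->
  spanning_tree (suspension e) (tree_set w x y z alpha R) /\
  forall b, tree_sign omega (tree_set w x y z alpha R) b <->
            b = tree_parity w x y z alpha R.
Proof.
case/and4P=> f exy eyz eR; have oR := edge_pairs_even eR.
have g := tree_triples_grown w x y z alpha R.
have fw : full (base y :: leaf_word (tree_triples w x y z alpha R)).
  by rewrite tree_leaf_word //; apply: full_tree_word.
have eyx : e y x by rewrite e_sym.
have [oz fz] := flipped_apex (~~ w) eyz; have [ox fx] := flipped_apex w eyx.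
split.
  apply: grown_spanning_tree fw g _ _ => // t /mapP[p]; rewrite 2!in_cons.
  case/or3P=> [/eqP->|/eqP->|/(pair_triples_edge eR)[a [b [eab -> _]]]] ->.
  - by rewrite triple_apex; apply: suspension_triple.
  - by rewrite triple_apex; apply: suspension_triple.
  exact: suspension_triple.
move=> b; have oN : odd (2 * n + 1 + 2) by rewrite -addnA oddD mul2n odd_double.
have oo t : t \in tree_triples w x y z alpha R -> cyc3_or_flip omega t.
  rewrite !inE => /or3P[/eqP->|/eqP->|/(pair_triples_edge eR)[c [d [ecd -> _]]]] //.
  exact: (flipped_pair _ ecd).1.
suff -> : tree_parity w x y z alpha R =
    odd (count (flipped omega) (tree_triples w x y z alpha R))
    (+) word_parity (base y :: leaf_word (tree_triples w x y z alpha R)).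
  exact: grown_tree_sign.
rewrite tree_leaf_word // /tree_parity addbC; congr (_ (+) _).
rewrite /= !oddD !oddb fz fx -addbA; congr (_ (+) (_ (+) _)).
elim/pair_ind: R eR {f g oR fw oo} => //= c d R IH /andP[ecd eR].
by rewrite oddD oddb (flipped_pair _ ecd).2 IH.
Qed.

Lemma tree_parity_rev w x y z alpha R : qpm_word x y z R ->
  tree_parity w x y z alpha R = tree_parity (~~ w) z y x alpha R.
Proof.
case/and4P=> f exy eyz eR; rewrite /tree_parity negbK /tree_word negbK.
rewrite [RHS]addbC [LHS]addbC; congr (_ (+) _); last first.
  apply: esym; apply: (@word_parity_block _ [:: base y] [:: base x;
    apex w] [:: base z; apex (~~ w)]).
  exact: (full_tree_word w f).
by congr (_ (+) _); rewrite addbC.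
Qed.

Lemma tree_parity_flip w x y z alpha R : qpm_word x y z R ->
  (tree_parity w x y z alpha R == tree_parity (~~ w) x y z alpha R) =
  (agreeing omega x y (+) agreeing omega y z).
Proof.
case/and4P=> f exy eyz eR; have eyx : e y x by rewrite e_sym.
rewrite !agreeingE // !(arrC _ eyx) /tree_parity /tree_word negbK.
have -> : word_parity ([:: base y; base z; apex w; base x; apex (~~ w)] ++ map base R) =
    ~~ word_parity ([:: base y; base z; apex (~~ w); base x; apex w] ++ map base R).
  have fw := full_tree_word w f; rewrite /tree_word in fw.
  have swap := @word_parity_swap _ [:: base y; base z; apex (~~ w)] (map base R) _ _ fw.
  rewrite -swap.
  apply: (@word_parity_block _ [:: base y; base z] [:: apex w;
    base x] [:: apex (~~ w)] (map base R)).
  rewrite -(full_perm (_ : perm_eq (tree_word w x y z R) _)) // /tree_word.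
  by rewrite (perm_cat2l [:: base y; base z;
    apex (~~ w)]) (perm_catCA [:: base x] [:: apex w]).
by case: w; rewrite /=; case: word_parity; case: (arr true y x); case: (arr false y x);
  case: (arr true y z); case: (arr false y z); case: pair_sum.
Qed.

(* The 5-path x1 x2 x3 x4 x5 contributes x1 x2 x3 | x4 x5 on the left and     *)
(* x1 x2 | x3 x4 x5 on the right.                                             *)
Lemma tree_parity_slide w x1 x2 x3 x4 x5 R : e x3 x4 ->
  qpm_word x1 x2 x3 [:: x4, x5 & R] ->
  (tree_parity w x1 x2 x3 (fun=> w) [:: x4, x5 & R] ==
   tree_parity w x5 x4 x3 (fun=> w) [:: x1, x2 & R]) =
  (arr (~~ w) x2 x3 == arr (~~ w) x4 x3).
Proof.
move=> e34 /and4P[f e12 e23 /= /andP[e45 eR]].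
rewrite /tree_parity /tree_word /= (arrC _ e12).
set s := map base R.
have fw : full ([:: base x2; base x3; apex (~~ w); base x1; apex w; base x4;
  base x5] ++ s).
  exact: (full_tree_word w f).
have -> : word_parity [:: base x4, base x3, apex (~~ w), base x5, apex w, base x1,
  base x2 & s] =
   ~~ word_parity [:: base x2, base x3, apex (~~ w), base x1, apex w, base x4, base
     x5 & s].
  pose u1 := [:: base x3; apex (~~ w); base x1; apex w].
  pose u2 := [:: base x4; base x3; apex (~~ w)].
  pose u3 := u2 ++ [:: base x5; apex w].
  have f1 : full (u2 ++ base x1 :: [:: apex w; base x2] ++ base x5 :: s).
    exact: (etrans (full_transpose [::] u1 (base x5 :: s) (base x2) (base x4)) fw).
  have f2 : full (u3 ++ base x2 :: base x1 :: s).
    exact: (etrans (full_transpose u2 [:: apex w; base x2] s (base x1) (base x5)) f1).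
  rewrite [LHS](word_parity_swap f2) [X in ~~ X](word_parity_transpose f1) negbK.
  exact: (@word_parity_transpose _ [::] u1 (base x5 :: s) _ _ fw).
case: (word_parity _); case: (arr w x1 x2); case: (arr w x4 x5);
  case: (arr (~~ w) x2 x3); case: (arr (~~ w) x4 x3); by case: (pair_sum _ R).
Qed.

Lemma tree_parity_assign w x y z alpha alpha' R :
  (forall P a b Q, R = P ++ [:: a, b & Q] -> odd (size P) = false ->
     arr (alpha a) a b = arr (alpha' a) a b) ->
  tree_parity w x y z alpha R = tree_parity w x y z alpha' R.
Proof.
move=> H; rewrite /tree_parity; congr (_ (+) (_ (+) _)).
elim/pair_ind: R H => //= a b R IH H; rewrite (H [::] a b R) // IH // => P c d Q RE oP.
by apply: (H [:: a, b & P] c d Q); rewrite /= ?RE ?oP.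
Qed.

Lemma tree_parity_pair_equiv w w' x y z P R R' : qpm_word x y z (P ++ R) ->
  odd (size P) = false -> pair_equiv R R' ->
  tree_parity w x y z (fun=> w') (P ++ R) = tree_parity w x y z (fun=> w') (P ++ R').
Proof.
case/and4P=> f exy eyz ePR oP RR'.
have /andP[eP eR] : edge_pairs e P && edge_pairs e R by rewrite -edge_pairs_cat.
have tw Q : tree_word w x y z (P ++ Q) = tree_word w x y z P ++ map base Q.
  by rewrite /tree_word map_cat catA.
have := full_tree_word w f; rewrite /tree_parity !tw !pair_sum_cat // => fw.
rewrite [LHS]addbCA [RHS]addbCA; congr (_ (+) _).
rewrite [LHS]addbCA [RHS]addbCA; congr (_ (+) _).
have fe a b : e a b -> ~~ arr w' b a = ~~ ~~ arr w' a b by move=> eab; rewrite arrC.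
exact: (pair_equiv_parity e_sym fe eR fw RR').
Qed.

Lemma tree_parity_cycle w w' x y z P c R : qpm_word x y z (P ++ c ++ R) ->
  odd (size P) = false -> odd (size c) = false -> c != [::] ->
  (tree_parity w x y z (fun=> w') (P ++ c ++ R) ==
   tree_parity w x y z (fun=> w') (P ++ rot 1 c ++ R)) =
  odd (count (fun a => arr w' a (next c a)) c).
Proof.
case/and4P=> f exy eyz _ oP oc c0; have fw := full_tree_word w f.
have uc : uniq c.
  by have := (fullP _ f).1; rewrite /= !cat_uniq => /and4P[_ _ _ /and3P[_ _ /and3P[]]].
have -> : odd (count (fun a => arr w' a (next c a)) c) =
    pair_sum (fun a b => ~~ arr w' a b) c (+) pair_sum (fun a b => ~~ arr w' a b)
      (rot 1 c).
  rewrite -count_next_rot //.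
  have := congr1 odd (count_predC (fun a => arr w' a (next c a)) c).
  rewrite oddD oc => /eqP; rewrite -[_ (+) _ == _]/(_ == _).
  by rewrite addbC => /eqP; case: odd; case: odd.
have tw Q : tree_word w x y z (P ++ Q) = tree_word w x y z P ++ map base Q.
  by rewrite /tree_word map_cat catA.
have or : odd (size (rot 1 c)) = false by rewrite size_rot.
rewrite /tree_parity.
have -> : word_parity (tree_word w x y z (P ++ rot 1 c ++ R)) =
    ~~ word_parity (tree_word w x y z (P ++ c ++ R)).
  move: fw oc; rewrite !tw; case: c c0 {f uc or} => // a s _ fw /= os.
  have fw' : full (tree_word w x y z P ++ base a :: map base s ++ map base R).
    by move: fw; rewrite map_cat.
  rewrite rot1_cons cat_rcons !map_cat.
  by rewrite [LHS](word_parity_move fw') size_map (negbFE os).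
move: (rot 1 c) or => rc or; rewrite !pair_sum_cat //.
case: word_parity; case: (pair_sum _ P); case: (pair_sum _ c); case: (pair_sum _ rc);
  case: (pair_sum _ R); case: (arr (~~ w) y z); by case: (arr w y x).
Qed.

End Suspension.

Arguments apex : simpl never.

Lemma has_cycle_seq (T : finType) (S : {set {set T}}) (x0 : T) (vs : seq T)
    (ts : seq {set T}) :
  1 < size vs -> size ts = size vs -> uniq vs -> uniq ts ->
  (forall i, i < size vs -> [/\ nth set0 ts i \in S, nth x0 vs i \in nth set0 ts i &
     nth x0 vs (i.+1 %% size vs) \in nth set0 ts i]) ->
  has_cycle S.
Proof.
move=> l2 st uv ut H.
exists (size vs), (fun i => nth x0 vs i), (fun i => nth set0 ts i); split=> //.
- by move=> i j /eqP; rewrite nth_uniq // => /eqP/val_inj.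
- by move=> i j /eqP; rewrite nth_uniq ?st // => /eqP/val_inj.
by move=> i; apply: H.
Qed.

Section SuspensionTrees.

Variables (n : nat) (e : rel 'I_(2 * n + 1)).
Hypotheses (e_sym : symmetric e) (e_irr : irreflexive e).

Notation V := 'I_(2 * n + 1).
Notation U := 'I_(2 * n + 1 + 2).
Notation base := (@susp_base n).
Notation apex := (apex n).
Implicit Types (x y z i j : V) (R : seq V) (alpha : V -> bool) (S : {set {set U}}).

Lemma base_in_triple k i j w : (base k \in susp_triple i j (apex w)) = (k == i) ||
  (k == j).
Proof. by rewrite !inE !(inj_eq (@base_inj n)) base_apex orbF. Qed.

Lemma apex_in_triple w' i j w : (apex w' \in susp_triple i j (apex w)) = (w' == w).
Proof.
by rewrite !inE (inj_eq (@apex_inj n)) ![apex w' == _]eq_sym !base_apex.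
Qed.

Lemma susp_triple_pair i j w t : t = susp_triple i j (apex w) ->
  [set k | base k \in t] = [set i; j].
Proof. by move=> ->; apply/setP => k; rewrite inE base_in_triple !inE. Qed.

Lemma pair_triples_sets alpha R :
  pair_sets R = [seq [set k | base k \in (t : {set U})] | t <- map (@triple _)
    (pair_triples alpha R)].
Proof.
elim/pair_ind: R => //= a b R ->.
by rewrite (@susp_triple_pair a b (alpha a)).
Qed.

Lemma pair_triples_exist alpha (ts : seq {set U}) :
  (forall t, t \in ts -> exists i j, e i j /\ t = susp_triple i j (apex (alpha i))) ->
  exists2 R, edge_pairs e R & map (@triple _) (pair_triples alpha R) = ts.
Proof.
elim: ts => [|t ts IH] H; first by exists [::].
have [i [j [eij ->]]] := H t (mem_head _ _).
have [t' t'ts|R eR <-] := IH; first by apply: H; rewrite inE t'ts orbT.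
by exists (i :: j :: R); rewrite //= eij.
Qed.

Section Decomposition.

Variable S : {set {set U}}.
Hypothesis S_tree : spanning_tree (suspension e) S.

Lemma tree_share t t' p q : t \in S -> t' \in S -> p != q ->
  p \in t -> q \in t -> p \in t' -> q \in t' -> t = t'.
Proof.
move=> tS t'S pq pt qt pt' qt'; apply/eqP; apply: contraT => tt'.
have [_ nS _ _] := S_tree; case: nS.
apply: (@has_cycle_seq _ S p [:: p; q] [:: t; t']); rewrite //= ?inE ?pq ?tt' //.
by case=> [|[|//]] _.
Qed.

Lemma tree_triple t i : t \in S -> base i \in t ->
  exists j w, e i j /\ t = susp_triple i j (apex w).
Proof.
have [/subsetP sub _ _ _] := S_tree.
move=> /sub/suspensionP[p [q [w [epq ->]]]]; rewrite base_in_triple => /orP[]/eqP->.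
  by exists q, w.
by exists p, w; rewrite e_sym susp_tripleC.
Qed.

Lemma tree_cover i : exists2 t, t \in S & base i \in t.
Proof.
have [_ _ cS _] := S_tree; have : base i \in cover S by rewrite cS inE.
by move=> /bigcupP[t tS it]; exists t.
Qed.

Definition attached w i := [exists t in S, (apex w \in t) && (base i \in t)].

Lemma attachedP w i : reflect (exists2 j, e i j & susp_triple i j (apex w) \in S)
  (attached w i).
Proof.
apply: (iffP existsP) => [[t /and3P[tS wt it]]|[j eij tS]].
  have [j [w' [eij tE]]] := tree_triple tS it; exists j => //.
  by move: wt; rewrite tE apex_in_triple => /eqP->; rewrite -tE.
by exists (susp_triple i j (apex w)); rewrite tS apex_in_triple base_in_triple !eqxx.
Qed.

Lemma tree_junction : exists y, attached true y && attached false y.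
Proof.
apply/existsP; apply: contraT => /existsPn no.
pose A := [pred p : U | (p == apex true) || [exists t in S, (apex true \in t) && (p
  \in t)]].
have [/subsetP sub _ _ con] := S_tree.
have AP p t : t \in S -> p \in t -> p \in A -> apex true \in t.
  move=> tS pt /orP[/eqP<- //|/existsP[t' /and3P[t'S ut' pt']]].
  have [i [j [w [eij tE]]]] := suspensionP (sub _ tS).
  have [i' [j' [w' [eij' tE']]]] := suspensionP (sub _ t'S).
  move: ut'; rewrite tE' apex_in_triple => /eqP w'E; rewrite -w'E in tE'.
  case: w tE => [tE|tE]; first by rewrite tE apex_in_triple.
  have [[k pE]|[w pE]] : (exists k, p = base k) \/ (exists w, p = apex w).
  - by move: pt; rewrite tE !inE -!orbA => /or3P[]/eqP->; [left; exists i|left;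
      exists j|right; exists false].
  - have /negP[] := no k; apply/andP; split; apply/existsP.
      by exists t'; rewrite t'S {1}tE' apex_in_triple -pE.
    by exists t; rewrite tS {1}tE apex_in_triple -pE.
  by move: pt pt'; rewrite pE tE tE' !apex_in_triple => /eqP->.
have clA : closed [rel a b | [exists t in S, (a \in t) && (b \in t)]] A.
  move=> p q /= /existsP[t /and3P[tS pt qt]]; apply/idP/idP => [pA|qA].
    by apply/orP; right; apply/existsP; exists t; rewrite tS qt (AP p).
  by apply/orP; right; apply/existsP; exists t; rewrite tS pt (AP q).
have := closed_connect clA (con (apex true) (apex false)).
rewrite !inE eqxx (inj_eq (@apex_inj n)) /= => /esym/existsP[t /and3P[tS ut vt]].
have [i [j [w [eij tE]]]] := suspensionP (sub _ tS).
by move: ut vt; rewrite tE !apex_in_triple => /eqP<-.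
Qed.

(* Two junctions would close up a cycle through u and v.                      *)
Lemma tree_junction_uniq y i : attached true y -> attached false y ->
  attached true i -> attached false i -> i = y.
Proof.
move=> /attachedP[x eyx t1S] /attachedP[z eyz t2S] /attachedP[j eij t4S]
  /attachedP[k eik t3S].
apply/eqP; apply: contraT => iy; have [_ nS _ _] := S_tree; case: nS.
have iy' : base i != base y by rewrite (inj_eq (@base_inj n)).
have yi' : base y != base i by rewrite eq_sym.
have uv : apex true != apex false by rewrite (inj_eq (@apex_inj n)).
have typ p q p' q' : (susp_triple p q (apex true) == susp_triple p' q' (apex
  false)) = false.
  by apply/eqP => /setP/(_ (apex true)); rewrite !apex_in_triple.
have typ' p q p' q' : (susp_triple p' q' (apex false) == susp_triple p q (apex
  true)) = false.
  by rewrite eq_sym.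
have ba p w : (base p == apex w) = false := base_apex p w.
have ab p w : (apex w == base p) = false by rewrite eq_sym.
have [E14|N14] := eqVneq (susp_triple y x (apex true)) (susp_triple i j (apex true)).
  have it1 : base i \in susp_triple y x (apex true) by rewrite E14 base_in_triple eqxx.
  have N23 : susp_triple y z (apex false) != susp_triple i k (apex false).
    apply/eqP => E23.
    have it2 : base i \in susp_triple y z (apex false) by rewrite E23
      base_in_triple eqxx.
    have := tree_share t1S t2S iy' it1 _ it2 _;
      rewrite !base_in_triple eqxx => /(_ isT isT)/eqP.
    by rewrite typ.
  apply: (@has_cycle_seq _ S (base y) [:: base y; apex false; base i]
    [:: susp_triple y z (apex false); susp_triple i k (apex false);
      susp_triple y x (apex true)]);
    rewrite //= ?inE ?negb_or ?ba ?ab ?typ' ?N23 ?iy' ?yi' ?(negPf uv) //=.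
  by case=> [|[|[|//]]] _; rewrite /= ?it1 ?base_in_triple ?apex_in_triple ?eqxx ?orbT.
have [E23|N23] := eqVneq (susp_triple y z (apex false)) (susp_triple i k (apex false)).
  have it2 : base i \in susp_triple y z (apex false) by rewrite E23 base_in_triple eqxx.
  apply: (@has_cycle_seq _ S (base y) [:: base y; apex true; base i]
    [:: susp_triple y x (apex true); susp_triple i j (apex true);
      susp_triple y z (apex false)]);
    rewrite //= ?inE ?negb_or ?ba ?ab ?typ ?N14 ?iy' ?yi' ?(negPf uv) //=.
  by case=> [|[|[|//]]] _; rewrite /= ?it2 ?base_in_triple ?apex_in_triple ?eqxx ?orbT.
apply: (@has_cycle_seq _ S (base y) [:: base y; apex false; base i; apex true]
    [:: susp_triple y z (apex false); susp_triple i k (apex false);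
        susp_triple i j (apex true); susp_triple y x (apex true)]).
- by [].
- by [].
- by rewrite /= !inE !negb_or !ba !ab yi' [_ == apex true]eq_sym uv.
- by rewrite /= !inE !negb_or !typ' N23 [_ == susp_triple y x _]eq_sym N14.
by case=> [|[|[|[|//]]]] _; rewrite /= ?base_in_triple ?apex_in_triple ?eqxx.
Qed.

Lemma spanning_tree_word :
  exists x y z alpha R, qpm_word e x y z R /\ S = tree_set true x y z alpha R.
Proof.
have [y /andP[uy vy]] := tree_junction.
have /attachedP[x eyx t1S] := uy; have /attachedP[z eyz t2S] := vy.
set t1 := susp_triple y x _ in t1S; set t2 := susp_triple y z _ in t2S.
have ba p w : base p != apex w by rewrite base_apex.
have yt t : t \in S -> base y \in t -> t = t1 \/ t = t2.
  move=> tS yt; have [j [w [_ tE]]] := tree_triple tS yt.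
  have wt : apex w \in t by rewrite tE apex_in_triple.
  case: w wt {tE} => wt; [left|right].
    by apply: (tree_share tS t1S (ba y true)) => //;
      rewrite ?base_in_triple ?apex_in_triple ?eqxx.
  by apply: (tree_share tS t2S (ba y false)) => //;
    rewrite ?base_in_triple ?apex_in_triple ?eqxx.
have att t i w : t \in S -> base i \in t -> apex w \in t -> attached w i.
  by move=> tS it wt; apply/existsP; exists t; rewrite tS wt.
have one i t t' : i != y -> t \in S -> t' \in S -> base i \in t -> base i \in t' ->
  t = t'.
  move=> iy tS t'S it it'.
  have [j [w [_ tE]]] := tree_triple tS it;
    have [j' [w' [_ tE']]] := tree_triple t'S it'.
  have wt : apex w \in t by rewrite tE apex_in_triple.
  have wt' : apex w' \in t' by rewrite tE' apex_in_triple.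
  have aw := att _ _ _ tS it wt; have aw' := att _ _ _ t'S it' wt'.
  have ww' : w = w'.
    apply/eqP; apply: contraTT iy => ww'; rewrite negbK; apply/eqP.
    by apply: tree_junction_uniq => //; case: w w' ww' aw aw' {tE tE' wt wt'} => [] [].
  by apply: tree_share tS t'S (ba i w) _ _ _ _ => //; rewrite ww'.
pose alpha := attached true.
have tsP t : t \in enum (S :\: [set t1; t2]) ->
    [/\ t \in S, t != t1, t != t2 & base y \notin t].
  rewrite mem_enum !inE negb_or => /andP[/andP[n1 n2] tS]; split=> //.
  by apply/negP => /(yt _ tS)[]E; [move: n1|move: n2]; rewrite E eqxx.
have [t /tsP[tS _ _ nyt]|R eR RE] := @pair_triples_exist alpha (enum (S :\: [set
  t1; t2])).
  have [/subsetP sub _ _ _] := S_tree.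
  have [i [j [w [eij tE]]]] := suspensionP (sub _ tS).
  exists i, j; split=> //; rewrite {1}tE; congr susp_triple; congr apex.
  have it : base i \in t by rewrite tE base_in_triple eqxx.
  have wt : apex w \in t by rewrite tE apex_in_triple.
  have aw := att _ _ _ tS it wt; apply/esym.
  case: w aw {tE wt} => // aw; apply: contraNF nyt => au.
  by rewrite -(tree_junction_uniq uy vy au aw).
exists x, y, z, alpha, R.
have RP A : A \in pair_sets R -> exists t, [/\ t \in S, t != t1, t != t2, base y
  \notin t & A = [set k | base k \in t]].
  by rewrite (pair_triples_sets alpha) RE => /mapP[t /tsP[]]; exists t.
have uR : uniq R.
  apply: (@pair_sets_uniq _ e) => //.
    rewrite (pair_triples_sets alpha) RE map_inj_in_uniq ?enum_uniq //.
    move=> t t' /tsP[tS _ _ nyt] /tsP[t'S _ _ nyt'] E.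
    have [/subsetP sub _ _ _] := S_tree.
    have [i [j [w [eij tE]]]] := suspensionP (sub _ tS).
    have it : base i \in t by rewrite tE base_in_triple eqxx.
    have it' : base i \in t' by have /setP/(_ i) := E; rewrite !inE it.
    by apply: (one i) => //; apply: contraNneq nyt => <-.
  move=> A B i /RP[t [tS _ _ nyt ->]] /RP[t' [t'S _ _ _ ->]]; rewrite !inE => it it'.
  by rewrite (one i t t') //; apply: contraNneq nyt => <-.
have nR i t : i \in R -> t \in S -> base i \in t -> t != t1 /\ t != t2.
  move=> /(pair_sets_cover eR)[A /RP[t' [t'S n1 n2 ny ->]]]; rewrite inE => it' tS it.
  rewrite (one i t t') //; apply: contraNneq ny => <- //.
have y1 : base y \in t1 by rewrite base_in_triple eqxx.
have x1 : base x \in t1 by rewrite base_in_triple eqxx orbT.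
have z2 : base z \in t2 by rewrite base_in_triple eqxx orbT.
have xR : x \notin R by apply/negP => /nR/(_ t1S x1)[]; rewrite eqxx.
have yR : y \notin R by apply/negP => /nR/(_ t1S y1)[]; rewrite eqxx.
have zR : z \notin R by apply/negP => /nR/(_ t2S z2)[]; rewrite eqxx.
have xy : x != y by rewrite eq_sym; apply: edge_neq eyx.
have yz : y != z by apply: edge_neq eyz.
have t12 : t1 != t2.
  by apply/eqP => /setP/(_ (apex true)); rewrite !apex_in_triple.
have xz : x != z.
  apply: contra t12 => /eqP E; apply/eqP.
  by apply: (one x) => //; rewrite E.
split.
  apply/and4P; split=> //; last by rewrite e_sym.
  apply/fullP; split.
    by rewrite /= !inE !negb_or xy xz xR yz yR zR uR.
  move=> i; have [t tS it] := tree_cover i; rewrite !inE.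
  have [E|n1] := eqVneq t t1.
    by move: it; rewrite E base_in_triple => /orP[]->; rewrite ?orbT.
  have [E|n2] := eqVneq t t2.
    by move: it; rewrite E base_in_triple => /orP[]->; rewrite ?orbT.
  have : [set k | base k \in t] \in pair_sets R.
    by rewrite (pair_triples_sets alpha) RE map_f // mem_enum !inE negb_or n1 n2.
  move=> tR; have -> : i \in R by apply: pair_sets_mem eR tR _; rewrite inE.
  by rewrite !orbT.
apply/setP => t; rewrite in_set /tree_set /= !in_cons RE mem_enum !triple_apex -/t1
  -/t2.
rewrite !inE negb_or.
have [->|n2] := eqVneq t t2; first by rewrite t2S.
by have [->|n1] := eqVneq t t1; first by rewrite t1S.
Qed.

End Decomposition.

End SuspensionTrees.

Lemma full_compl (T : finType) (s t : seq T) : full (s ++ t) ->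
  ~: [set x in t] = [set x in s].
Proof.
case/fullP=> u m; apply/setP => x; rewrite !inE.
have := m x; rewrite mem_cat; case xs: (x \in s) => //=; last by move->.
by move: u; rewrite cat_uniq => /and3P[_ /hasPn H _] _; apply: contraTN isT => /H;
  rewrite xs.
Qed.

Lemma full_of_compl (T : finType) (s t : seq T) : uniq s -> uniq t ->
  ~: [set x in t] = [set x in s] -> full (s ++ t).
Proof.
move=> us ut E; have st x : (x \in s) = (x \notin t) by move/setP/(_ x): E;
  rewrite !inE.
apply/fullP; rewrite cat_uniq us ut andbT; split.
  by apply/hasPn => x xt; rewrite /= st xt.
by move=> x; rewrite mem_cat st; case: (x \in t).
Qed.

(** * The sign as an invariant of quasi-perfect matchings *)

Section Conditions.

Variables (n : nat) (e : rel 'I_(2 * n + 1)).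
Variable omega : {set 'I_(2 * n + 1 + 2)} -> {perm 'I_(2 * n + 1 + 2)}.
Hypotheses (e_sym : symmetric e) (e_irr : irreflexive e).
Hypothesis omega_or : orientation (suspension e) omega.

Notation V := 'I_(2 * n + 1).
Notation arr := (arr omega).
Notation qpm_word := (qpm_word e).
Notation tree_parity := (tree_parity omega).
Implicit Types (x y z i j a b : V) (R : seq V) (alpha : V -> bool).

Lemma agreeing_sym i j : agreeing omega i j = agreeing omega j i.
Proof. by rewrite /agreeing !(susp_tripleC i j). Qed.

Lemma qpm_word_rev x y z R : qpm_word x y z R -> qpm_word z y x R.
Proof.
case/and4P=> f exy eyz eR; apply/and4P; split; rewrite // 1?e_sym //.
exact: etrans (full_transpose [::] [:: y] R x z) f.
Qed.

Lemma qpm_slide x1 x2 x3 x4 x5 R : e x3 x4 -> qpm_word x1 x2 x3 [:: x4, x5 & R] ->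
  qpm_word x5 x4 x3 [:: x1, x2 & R].
Proof.
move=> e34 /and4P[f e12 e23 /= /andP[e45 eR]].
apply/and4P; split; rewrite /= ?e12 1?e_sym ?e45 ?e34 //.
rewrite -(full_perm (_ : perm_eq ([:: x1; x2; x3; x4; x5] ++ R) _)) //=.
apply/seq.permP => p /=; move: (p x1 : nat) (p x2 : nat) (p x3 : nat) (p x4 : nat)
  (p x5 : nat).
by lia.
Qed.

Section PfaffianToConditions.

Variable s : bool.
Hypothesis parity_s : forall w x y z alpha R,
  qpm_word x y z R -> tree_parity w x y z alpha R = s.

Lemma pfaffian_agreeing x y z a b R : qpm_word x y z [:: a, b & R] ->
  agreeing omega a b.
Proof.
move=> q; have /and4P[f _ _ /= /andP[eab eR]] := q.
have uR : uniq [:: a, b & R] by have /and4P[] := (fullP _ f).1.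
rewrite (agreeingE e_sym e_irr omega_or eab).
have := parity_s true (fun i => i != a) q.
rewrite -(parity_s true (fun=> true) q) /tree_parity /= eqxx.
have -> : pair_sum (fun c d => ~~ arr (c != a) c d) R = pair_sum (fun c d => ~~ arr
  true c d) R.
  have : a \notin R by move: uR; rewrite /= inE negb_or -andbA => /and3P[].
  elim/pair_ind: R {q f eR uR} => //= c d R IH;
    rewrite !inE !negb_or => /and3P[ac _ aR].
  by rewrite IH // eq_sym ac.
by case: word_parity; case: (arr true a b); case: (arr false a b); case: pair_sum;
  case: (arr _ y z); case: (arr _ y x).
Qed.

Lemma pfaffian_cycle c : even_cycle e c ->
  has_quasi_perfect_matching e (~: [set x in c]) ->
  (forall x, x \in c -> agreeing omega x (next c x)) /\ oddly_oriented omega c.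
Proof.
case/and4P=> c2 oc uc cc /(quasi_perfect_matching_word e_sym e_irr)[x [y [z [R [u
  exy eyz eR E]]]]].
have f := full_of_compl u uc E; move/negbTE in oc.
have c0 : c != [::] by case: (c) c2.
have q k : qpm_word x y z (rot k c ++ R).
  apply/and4P; split=> //.
    rewrite -(full_perm (_ : perm_eq ([:: x, y, z & R] ++ c) _)) //= !perm_cons
      perm_catC.
    by rewrite perm_cat2r perm_sym perm_rot.
  have ck : path.cycle e (rot k c) by rewrite rot_cycle.
  rewrite edge_pairs_cat ?size_rot // eR andbT.
  move: ck; rewrite even_cycle_pairs ?size_rot // => [/andP[]//|].
  by rewrite -size_eq0 size_rot size_eq0.
split=> [a ac|].
  have [k t ck] := rot_to ac; have := q k; rewrite ck -(next_rot k uc) ck.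
  have : 2 <= size (a :: t) by rewrite -ck size_rot.
  case: t ck => // b t ck _ /= /pfaffian_agreeing.
  by rewrite eqxx.
have q0 : qpm_word x y z ([::] ++ c ++ R) by have := q 0; rewrite rot0.
have := @tree_parity_cycle n e omega true true x y z [::] c R q0 erefl oc c0.
by rewrite !parity_s ?eqxx //; exact: (q 1).
Qed.

Lemma pfaffian_path2 x y z : uniq [:: x; y; z] -> e x y -> e y z ->
  has_perfect_matching e (~: [set x; y; z]) ->
  (agreeing omega x y /\ opposite omega y z) \/
  (opposite omega x y /\ agreeing omega y z).
Proof.
move=> u exy eyz /(perfect_matchingP e_irr)[R [uR eR E]].
have q : qpm_word x y z R.
  apply/and4P; split=> //; apply: (full_of_compl (s := [:: x; y; z])) => //.
  by rewrite -E setCK; apply/setP => i; rewrite !inE orbA.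
have := tree_parity_flip e_sym e_irr omega_or true (fun=> true) q.
rewrite !parity_s // eqxx /opposite; case: agreeing; case: agreeing => //; auto.
Qed.

Lemma pfaffian_path4 x1 x2 x3 x4 x5 : uniq [:: x1; x2; x3; x4; x5] ->
  e x1 x2 -> e x2 x3 -> e x3 x4 -> e x4 x5 ->
  has_perfect_matching e (~: [set x in [:: x1; x2; x3; x4; x5]]) ->
  forall w, arr w x2 x3 = arr w x4 x3.
Proof.
move=> u e12 e23 e34 e45 /(perfect_matchingP e_irr)[R [uR eR E]] w.
have f : full ([:: x1; x2; x3; x4; x5] ++ R).
  by apply: full_of_compl => //; rewrite -E setCK.
have q : qpm_word x1 x2 x3 [:: x4, x5 & R] by apply/and4P; split; rewrite //= e45.
have q' := qpm_slide e34 q.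
have := tree_parity_slide e_sym e_irr omega_or (~~ w) e34 q.
by rewrite !parity_s // eqxx negbK => /esym/eqP.
Qed.

End PfaffianToConditions.

Section ConditionsToPfaffian.

Hypothesis cycle_cond : forall c : seq V, even_cycle e c ->
  has_quasi_perfect_matching e (~: [set x in c]) ->
  (forall x, x \in c -> agreeing omega x (next c x)) /\ oddly_oriented omega c.
Hypothesis path2_cond : forall x y z, uniq [:: x; y; z] -> e x y -> e y z ->
  has_perfect_matching e (~: [set x; y; z]) ->
  (agreeing omega x y /\ opposite omega y z) \/
  (opposite omega x y /\ agreeing omega y z).
Hypothesis path4_cond : forall x1 x2 x3 x4 x5,
  uniq [:: x1; x2; x3; x4; x5] -> e x1 x2 -> e x2 x3 -> e x3 x4 -> e x4 x5 ->
  has_perfect_matching e (~: [set x in [:: x1; x2; x3; x4; x5]]) ->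
  forall w, arr w x2 x3 = arr w x4 x3.

Lemma cond_cycle x y z P c Q : full [:: x, y, z & P ++ c ++ Q] -> e x y -> e y z ->
  edge_pairs e (P ++ Q) -> even_cycle e c ->
  (forall i, i \in c -> agreeing omega i (next c i)) /\ oddly_oriented omega c.
Proof.
move=> f exy eyz eR ec; apply: cycle_cond => //.
have f' : full ([:: x, y, z & P ++ Q] ++ c).
  by rewrite (full_perm (_ : perm_eq _ [:: x, y, z & P ++ c ++ Q])) //= !perm_cons
    -catA perm_cat2l perm_catC.
rewrite (full_compl f'); apply: word_quasi_perfect_matching => //.
by have := (fullP _ f').1; rewrite cat_uniq => /andP[].
Qed.

Lemma cond_pair x y z P a b Q : odd (size P) = false ->
  qpm_word x y z (P ++ [:: a, b & Q]) -> agreeing omega a b.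
Proof.
move=> oP /and4P[f exy eyz]; rewrite edge_pairs_cat // => /and3P[eP eab eQ].
have [] := @cond_cycle x y z P [:: a; b] Q f exy eyz.
- by rewrite edge_pairs_cat // eP.
- by rewrite /even_cycle /= inE (edge_neq e_irr eab) eab e_sym eab.
by move=> /(_ a); rewrite /= mem_head eqxx => /(_ isT).
Qed.

Lemma cond_path x y z R : qpm_word x y z R -> agreeing omega x y (+) agreeing omega y z.
Proof.
case/and4P=> f exy eyz eR; have [u _] := fullP _ f.
have u3 : uniq [:: x; y; z] by move: u; rewrite (cat_uniq [:: x; y; z]) => /andP[].
have pm : has_perfect_matching e (~: [set x; y; z]).
  apply/(perfect_matchingP e_irr); exists R; split=> //; first by have /and4P[] := u.
  rewrite -(full_compl (s := R) (t := [:: x; y; z])).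
    by congr (~: _); apply/setP => i; rewrite !inE orbA.
  by rewrite (full_perm (_ : perm_eq _ [:: x, y, z & R])) // perm_catC.
by have [[-> /negPf->]|[/negPf-> ->]] := path2_cond u3 exy eyz pm.
Qed.

Definition kappa x y z R := tree_parity true x y z (fun=> true) R.

Lemma kappaE w x y z alpha R : qpm_word x y z R ->
  tree_parity w x y z alpha R = kappa x y z R.
Proof.
move=> q; have -> : tree_parity w x y z alpha R = tree_parity w x y z (fun=> true) R.
  apply: tree_parity_assign => P a b Q RE oP; rewrite RE in q.
  have := cond_pair oP q; rewrite (agreeingE e_sym e_irr omega_or).
    by case: (alpha a) => // /eqP.
  by case/and4P: q => _ _ _; rewrite edge_pairs_cat // => /and3P[].
case: w => //; have := tree_parity_flip e_sym e_irr omega_or true (fun=> true) q.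
by rewrite (cond_path q) => /eqP <-.
Qed.

Lemma kappa_rev x y z R : qpm_word x y z R -> kappa x y z R = kappa z y x R.
Proof.
by move=> q; rewrite /kappa (tree_parity_rev _ _ _ q) kappaE //; apply: qpm_word_rev.
Qed.

Lemma qpm_pair_equiv x y z R R' : qpm_word x y z R -> pair_equiv R R' ->
  qpm_word x y z R'.
Proof.
case/and4P=> f exy eyz eR RR'; apply/and4P; split=> //;
  last by rewrite -(pair_equiv_edges e_sym RR').
by rewrite -(full_perm (_ : perm_eq [:: x, y, z & R] _)) // !perm_cons pair_equiv_perm.
Qed.

Lemma kappa_pair_equiv x y z P R R' : qpm_word x y z (P ++ R) ->
  odd (size P) = false -> pair_equiv R R' ->
  kappa x y z (P ++ R) = kappa x y z (P ++ R').
Proof. exact: tree_parity_pair_equiv. Qed.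

Lemma kappa_slide x1 x2 x3 x4 x5 R : e x3 x4 -> qpm_word x1 x2 x3 [:: x4, x5 & R] ->
  kappa x1 x2 x3 [:: x4, x5 & R] = kappa x5 x4 x3 [:: x1, x2 & R].
Proof.
move=> e34 q; apply/eqP; rewrite /kappa (tree_parity_slide e_sym e_irr omega_or
  true e34 q); apply/eqP.
have /and4P[f e12 e23 /= /andP[e45 eR]] := q; have [u _] := fullP _ f.
apply: (@path4_cond x1 x2 x3 x4 x5) => //.
  by move: u; rewrite (cat_uniq [:: x1; x2; x3; x4; x5]) => /andP[].
apply/(perfect_matchingP e_irr); exists R; split=> //; first by move: u;
  rewrite (cat_uniq [:: x1; x2; x3; x4; x5]) => /and3P[].
rewrite -(full_compl (s := R) (t := [:: x1; x2; x3; x4; x5])) //.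
by rewrite (full_perm (_ : perm_eq _ ([:: x1; x2; x3; x4; x5] ++ R))) // perm_catC.
Qed.

Lemma qpm_word_perm x y z P R R' : qpm_word x y z (P ++ R) ->
  qpm_word x y z (P ++ R') -> perm_eq R R'.
Proof.
case/and4P=> f _ _ _ /and4P[f' _ _ _]; rewrite -(perm_cat2l [:: x, y, z & P]) /=.
by rewrite (perm_trans f) // perm_sym.
Qed.

(* Kasteleyn's argument: the alternating cycles of two matchings that extend  *)
(* the same path are switched one after the other.                            *)
Lemma kappa_matchings x y z P R R' : odd (size P) = false ->
  qpm_word x y z (P ++ R) -> qpm_word x y z (P ++ R') ->
  kappa x y z (P ++ R) = kappa x y z (P ++ R').
Proof.
move: {2}(size R) (leqnn (size R)) => k.
elim: k P R R' => [|k IH] P R R' sR oP q q'; have pRR' := qpm_word_perm q q'.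
  by move: sR pRR'; rewrite leqn0 => /nilP->; rewrite perm_sym => /perm_nilP->.
have [R0|R0] := eqVneq R [::].
  by move: pRR'; rewrite R0 perm_sym => /perm_nilP->.
have eR : edge_pairs e R by case/and4P: q => _ _ _;
  rewrite edge_pairs_cat // => /andP[].
have eR' : edge_pairs e R' by case/and4P: q' => _ _ _;
  rewrite edge_pairs_cat // => /andP[].
have [c [Q [Q' [c0 oc RQ RQ' pQ]]]] := alternating_cycle e_sym eR eR' pRR' R0.
have qc := qpm_pair_equiv q (pair_equiv_catl oP RQ).
have qc' := qpm_pair_equiv q' (pair_equiv_catl oP RQ').
rewrite (kappa_pair_equiv q oP RQ) (kappa_pair_equiv q' oP RQ').
have or : odd (size (rot 1 c)) = false by rewrite size_rot.
have /and4P[f exy eyz] := qc; rewrite !edge_pairs_cat // => /and3P[eP ec eQ].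
have /and4P[_ _ _] := qc'; rewrite edge_pairs_cat // (@edge_pairs_cat _ _ _ _ or)
  => /and3P[_ er eQ'].
have evc : even_cycle e c.
  rewrite /even_cycle oc even_cycle_pairs // ec er !andbT /=; apply/andP; split.
    by case: (c) c0 oc => // a [].
  by have := (fullP _ f).1; rewrite /= !cat_uniq => /and4P[_ _ _ /and3P[_ _ /and3P[]]].
have [] := cond_cycle f exy eyz _ evc; first by rewrite edge_pairs_cat // eP.
move=> _ oo; have := tree_parity_cycle omega true true qc oP oc c0.
rewrite [RHS]oo => /eqP; rewrite -!/(kappa _ _ _ _) => ->.
rewrite (catA P _ Q) (catA P _ Q'); apply: IH.
- have := perm_size (pair_equiv_perm RQ); rewrite size_cat => E.
  have c1 : 0 < size c by case: (c) c0.
  by rewrite -ltnS; apply: leq_trans sR; rewrite E -[X in X < _]add0n ltn_add2r.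
- by rewrite (size_cat P) oddD oP or.
- apply/and4P; split=> //; last by rewrite -catA edge_pairs_cat // (@edge_pairs_cat
    _ _ _ _ or) eP er.
  rewrite -(full_perm (_ : perm_eq [:: x, y, z & P ++ c ++ Q] _)) // !perm_cons -catA.
  by rewrite perm_cat2l perm_cat2r perm_sym perm_rot.
by rewrite -catA.
Qed.

Definition word_edges x y z R : {set {set V}} := [set A in pair_sets [:: x, y, y, z
  & R]].

Lemma word_edges_rev x y z R : word_edges z y x R = word_edges x y z R.
Proof.
by apply/setP => A; rewrite !inE /= ![[set y; _]]setUC orbCA.
Qed.

Lemma pair_equiv_sets R R' : pair_equiv R R' -> pair_sets R =i pair_sets R'.
Proof.
elim=> {R R'} [R|a b R R' _ IH|a b R|a b c d R|R1 R2 R3 _ H1 _ H2] A //=.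
- by rewrite !inE IH.
- by rewrite !inE setUC.
- by rewrite !inE orbCA.
by rewrite H1.
Qed.

Lemma word_edge x y z R i : qpm_word x y z R ->
  exists a, e i a /\ [set i; a] \in word_edges x y z R.
Proof.
case/and4P=> /fullP[u m] exy eyz eR.
have eW : edge_pairs e [:: x, y, y, z & R] by rewrite /= exy eyz.
have iW : i \in [:: x, y, y, z & R].
  by have := m i; rewrite !inE => /or4P[]->; rewrite ?orbT.
have [A AW iA] := pair_sets_cover eW iW.
have [a [b [eab AE _ _]]] := pair_sets_edge eW AW.
move: iA; rewrite AE !inE => /orP[]/eqP->.
  by exists b; rewrite -AE inE.
by exists a; rewrite setUC -AE inE e_sym.
Qed.

Lemma word_edges_branch x y z R i j k : qpm_word x y z R -> e i j -> e i k ->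
  [set i; j] \in word_edges x y z R -> [set i; k] \in word_edges x y z R ->
  j != k -> i = y /\ ((j = x /\ k = z) \/ (j = z /\ k = x)).
Proof.
case/and4P=> /fullP[u m] exy eyz eR eij eik.
have ij := edge_neq e_irr eij; have ik := edge_neq e_irr eik.
have uR : uniq R by have /and4P[] := u.
have [xR yR zR] : [/\ x \notin R, y \notin R & z \notin R].
  by move: u; rewrite /= !inE !negb_or -!andbA => /and5P[_ _ -> _ /and3P[-> -> _]].
have [xy xz yz] : [/\ x != y, x != z & y != z].
  by move: u; rewrite /= !inE !negb_or -!andbA => /and5P[-> -> _ -> _].
have nR l : [set i; l] \in pair_sets R -> i \in R.
  by move=> lR; apply: pair_sets_mem eR lR (set21 _ _).
have cases l : e i l -> [set i; l] \in word_edges x y z R ->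
    [set i; l] \in pair_sets R \/
    i \notin R /\ [\/ i = x /\ l = y, i = y /\ l = x, i = y /\ l = z | i = z /\ l = y].
  move=> eil; rewrite !inE /= => /or3P[/eqP E|/eqP E|lR]; [right|right|by left].
    by have [[-> ->]|[-> ->]] := set2_inj E (edge_neq e_irr eil); split=> //;
      [constructor 1|constructor 2].
  by have [[-> ->]|[-> ->]] := set2_inj E (edge_neq e_irr eil); split=> //;
    [constructor 3|constructor 4].
move=> Ej Ek jk; case: (cases j eij Ej) => [jR|[iR Hj]];
  case: (cases k eik Ek) => [kR|[iR' Hk]].
- have /setP/(_ j) := pair_sets_meet uR eR jR kR (set21 _ _) (set21 _ _).
  by rewrite !inE eqxx orbT [j == i]eq_sym (negPf ij) (negPf jk).
- by rewrite (nR _ jR) in iR'.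
- by rewrite (nR _ kR) in iR.
move/eqP: xy => xy; move/eqP: xz => xz; move/eqP: yz => yz; move/eqP: jk => jk.
by case: Hj => -[iE jE]; case: Hk => -[iE' kE]; first
  [exfalso; congruence | split; [congruence | first [left; split;
    congruence | right; split; congruence]]].
Qed.

Lemma cond_extend x y z R a : qpm_word x y z R -> e x a -> a \in R ->
  exists b R2, [/\ pair_equiv R [:: a, b & R2],
    qpm_word b a x [:: z, y & R2] & kappa x y z R = kappa b a x [:: z, y & R2]].
Proof.
move=> q exa aR; have eR : edge_pairs e R by case/and4P: q.
have [b [R2 RR2]] := pair_equiv_extract eR aR.
have q2 := qpm_word_rev (qpm_pair_equiv q RR2).
exists b, R2; split=> //; first exact: qpm_slide q2.
rewrite -(kappa_slide exa q2) -(kappa_rev (qpm_pair_equiv q RR2)).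
exact: (@kappa_pair_equiv x y z [::]).
Qed.

Lemma cond_extend_agreeing x y z R a : qpm_word x y z R -> e x a -> a \in R ->
  agreeing omega z y.
Proof.
by move=> q exa aR; have [b [R2 [_ q2 _]]] := cond_extend q exa aR;
  apply: (@cond_pair _ _ _ [::]) q2.
Qed.

Lemma cond_one_extension x y z R a c : qpm_word x y z R -> e x a -> a \in R ->
  e z c -> c \in R -> False.
Proof.
move=> q exa aR ezc cR; have := cond_path q.
rewrite (cond_extend_agreeing (qpm_word_rev q) ezc cR) agreeing_sym.
by rewrite (cond_extend_agreeing q exa aR).
Qed.

Lemma cond_no_triangle x y z R : qpm_word x y z R -> e x z = false.
Proof.
move=> q; apply/negP => exz; have /and4P[f exy eyz eR] := q.
have q2 : qpm_word y z x R.
  apply/and4P; split; rewrite // 1?e_sym //.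
  by rewrite -(full_perm (_ : perm_eq [:: x, y, z & R] _)) // (permEl (perm_catCA
    [:: x] [:: y; z] R)).
have q3 : qpm_word z x y R.
  apply/and4P; split; rewrite // 1?e_sym //.
  by rewrite -(full_perm (_ : perm_eq [:: x, y, z & R] _)) // (permEl (perm_catCA
    [:: x; y] [:: z] R)).
move: (cond_path q) (cond_path q2) (cond_path q3).
by case: agreeing; case: agreeing; case: agreeing.
Qed.

Lemma word_mem x y z R i : qpm_word x y z R -> [|| i == x, i == y, i == z | i \in R].
Proof. by case/and4P=> /fullP[_ /(_ i)]; rewrite !inE. Qed.

(* Replacing the edge x y by x a brings the word closer to the target, since  *)
(* x a is an edge of the target and x y is not.                               *)
Lemma cond_progress x y z R x' y' z' R' a :
  qpm_word x y z R -> qpm_word x' y' z' R' -> e x a -> a \in R ->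
  [set x; a] \in word_edges x' y' z' R' -> [set z; y] \in word_edges x' y' z' R' ->
  exists x1 y1 z1 R1, [/\ qpm_word x1 y1 z1 R1, kappa x y z R = kappa x1 y1 z1 R1 &
    #|word_edges x' y' z' R' :\: word_edges x1 y1 z1 R1| <
    #|word_edges x' y' z' R' :\: word_edges x y z R|].
Proof.
move=> q q' exa aR xaE zyE; have /and4P[/fullP[u _] exy eyz eR] := q.
have [xR yR zR] : [/\ x \notin R, y \notin R & z \notin R].
  by move: u; rewrite /= !inE !negb_or -!andbA => /and5P[_ _ -> _ /and3P[-> -> _]].
have [xy xz yz] : [/\ x != y, x != z & y != z].
  by move: u; rewrite /= !inE !negb_or -!andbA => /and5P[-> -> _ -> _].
have [b [R2 [RR2 q2 kE]]] := cond_extend q exa aR.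
exists b, a, x, [:: z, y & R2]; split=> //.
have xyE : [set x; y] \notin word_edges x' y' z' R'.
  apply/negP => xyE; have ay : a != y by apply: contraNneq yR => <-.
  have eyx : e y x by rewrite e_sym.
  have [xy' _] := word_edges_branch q' exa exy xaE xyE ay.
  have [||yy' _] := word_edges_branch q' eyx eyz _ _ xz; try by rewrite setUC.
  by move: xy; rewrite xy' yy' eqxx.
apply: proper_card; apply/properP; split.
  apply/subsetP => A; rewrite in_setD in_setD => /andP[n1 AE]; rewrite AE andbT.
  apply: contra n1; rewrite !inE /= => /or3P[/eqP AA|/eqP->|].
  - by rewrite AA (negPf xyE) in AE.
  - by rewrite [[set y; z]]setUC eqxx !orbT.
  by rewrite (pair_equiv_sets RR2) /= inE => /orP[/eqP->|->];
    rewrite ?orbT // setUC eqxx.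
exists [set x; a]; rewrite in_setD xaE ?andbT.
  rewrite !inE /= !negb_or; apply/and3P; split.
  - apply/eqP => /setP/(_ a); rewrite !inE eqxx orbT => /esym/orP[]/eqP E.
      by rewrite -E aR in xR.
    by rewrite -E aR in yR.
  - apply/eqP => /setP/(_ x); rewrite !inE eqxx => /esym; rewrite (negPf xy) (negPf xz).
    by [].
  by apply: contra xR => /(pair_sets_mem eR); apply; rewrite set21.
by rewrite negbK !inE /= [[set x; a]]setUC eqxx !orbT.
Qed.

Lemma kappa_const x y z R x' y' z' R' : qpm_word x y z R -> qpm_word x' y' z' R' ->
  kappa x y z R = kappa x' y' z' R'.
Proof.
move=> q q'; have [k] := ubnP #|word_edges x' y' z' R' :\: word_edges x y z R|.
elim: k x y z R q => // k IH x y z R q ltk.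
have [a [exa xaE]] := word_edge x q'; have [c [ezc zcE]] := word_edge z q'.
have qr := qpm_word_rev q.
have step x0 z0 a0 : qpm_word x0 y z0 R -> kappa x y z R = kappa x0 y z0 R ->
    word_edges x0 y z0 R = word_edges x y z R -> e x0 a0 -> a0 \in R ->
    [set x0; a0] \in word_edges x' y' z' R' -> [set z0; y] \in word_edges x' y' z' R' ->
    kappa x y z R = kappa x' y' z' R'.
  move=> q0 k0 E0 exa0 aR0 aE0 zE0.
  have [x1 [y1 [z1 [R1 [q1 k1 lt1]]]]] := cond_progress q0 q' exa0 aR0 aE0 zE0.
  rewrite k0 k1; apply: IH => //.
  by rewrite E0 in lt1; apply: leq_trans lt1 _; rewrite -ltnS.
have ends p i j : qpm_word i y j R -> e i p -> p = y \/ p \in R.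
  move=> qij eip; have /or4P[/eqP pE|/eqP->|/eqP pE|] := word_mem p qij; auto.
    by rewrite pE e_irr in eip.
  by rewrite pE (cond_no_triangle qij) in eip.
have [ay|aR] := ends a x z q exa; have [cy|cR] := ends c z x qr ezc.
- rewrite ay in exa xaE; rewrite cy in ezc zcE.
  have [eyx eyz] : e y x /\ e y z by rewrite ![e y _]e_sym.
  have xz : x != z by have /and4P[/fullP[/andP[]]] := q;
    rewrite !inE !negb_or => /and3P[].
  have [||yE E] := word_edges_branch q' eyx eyz _ _ xz; try by rewrite setUC.
  have main : forall R0, qpm_word x' y' z' R0 -> kappa x' y' z' R0 = kappa x' y' z' R'.
    by move=> R0 q0; apply: (@kappa_matchings x' y' z' [::]).
  case: E => -[xE zE]; rewrite yE xE zE in q qr *; first exact: main.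
  by rewrite kappa_rev //; apply: main.
- apply: (step z x c) => //; [exact: kappa_rev | exact: word_edges_rev | by rewrite
    -ay].
- by apply: (step x z a) => //; rewrite -cy.
by case: (cond_one_extension q exa aR ezc cR).
Qed.

End ConditionsToPfaffian.

End Conditions.

Theorem theorem5p10 (n : nat) (e : rel 'I_(2 * n + 1))
    (e_sym : symmetric e) (e_irr : irreflexive e)
    (omega : {set 'I_(2 * n + 1 + 2)} -> {perm 'I_(2 * n + 1 + 2)})
    (omega_or : orientation (suspension e) omega) :
  three_pfaffian (suspension e) omega <->
  [/\ (forall c : seq 'I_(2 * n + 1),
         even_cycle e c ->
         has_quasi_perfect_matching e (~: [set x in c]) ->
         (forall x, x \in c -> agreeing omega x (next c x)) /\
         oddly_oriented omega c),
      (forall x y z : 'I_(2 * n + 1),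
         uniq [:: x; y; z] -> e x y -> e y z ->
         has_perfect_matching e (~: [set x; y; z]) ->
         (agreeing omega x y /\ opposite omega y z) \/
         (opposite omega x y /\ agreeing omega y z)) &
      (forall x1 x2 x3 x4 x5 : 'I_(2 * n + 1),
         uniq [:: x1; x2; x3; x4; x5] ->
         e x1 x2 -> e x2 x3 -> e x3 x4 -> e x4 x5 ->
         has_perfect_matching e (~: [set x in [:: x1; x2; x3; x4; x5]]) ->
         (arrow omega (susp_u n) x2 x3 <-> arrow omega (susp_u n) x4 x3) /\
         (arrow omega (susp_v n) x2 x3 <-> arrow omega (susp_v n) x4 x3))].
Proof.
split=> [[b Hb] | [H1 H2 H3]].
  have par w x y z alpha R : qpm_word e x y z R -> tree_parity omega w x y z alpha R = b.
    move=> q; have [tr sg] := tree_setP e_sym e_irr omega_or w alpha q.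
    by have /sg := Hb _ tr.
  split.
  - exact: (pfaffian_cycle e_sym e_irr omega_or par).
  - exact: (pfaffian_path2 e_sym e_irr omega_or par).
  move=> x1 x2 x3 x4 x5 u e12 e23 e34 e45 pm.
  have E := pfaffian_path4 e_sym e_irr omega_or par u e12 e23 e34 e45 pm.
  by have := E true; have := E false; rewrite /arr => -> ->.
have H3' x1 x2 x3 x4 x5 : uniq [:: x1; x2; x3; x4; x5] ->
    e x1 x2 -> e x2 x3 -> e x3 x4 -> e x4 x5 ->
    has_perfect_matching e (~: [set x in [:: x1; x2; x3; x4; x5]]) ->
    forall w, arr omega w x2 x3 = arr omega w x4 x3.
  move=> u e12 e23 e34 e45 pm w; have [Hu Hv] := H3 _ _ _ _ _ u e12 e23 e34 e45 pm.
  by apply/idP/idP; case: w => [/Hu|/Hv].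
pose word (W : (2 * n + 1).-tuple 'I_(2 * n + 1)) :=
  if tval W is x :: y :: z :: R then qpm_word e x y z R else false.
have [W | noW] := pickP word.
  rewrite /word; case: (tval W) => [|x [|y [|z R]]] // q.
  exists (kappa omega x y z R) => S trS.
  have [x1 [y1 [z1 [alpha [R1 [q1 ->]]]]]] := spanning_tree_word e_sym e_irr trS.
  apply/(tree_setP e_sym e_irr omega_or true alpha q1).2.
  rewrite (kappaE e_sym e_irr omega_or H1 H2 true alpha q1).
  exact: (kappa_const e_sym e_irr omega_or H1 H2 H3' q q1).
exists true => S trS; have [x [y [z [alpha [R [q _]]]]]] := spanning_tree_word e_sym e_irr trS.
have sW : size [:: x, y, z & R] == 2 * n + 1.
  by case/and4P: q => f _ _ _; rewrite (full_size f) card_ord.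
by have := noW (Tuple sW); rewrite /word /= q.
Qed.
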